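(* Let $B$ and $H$ be totally disconnected locally compact groups, $A$ a compact open subgroup of $B$, and $\Gamma$ a graph on which $H$ acts continuously (with $\Gamma$ discrete). Let $G$ be the graph-wreath product of $B$ and $H$ over $\Gamma$ relative to $A$. (i) If $B$ and $H$ are compactly generated, and $H$ acts on the vertices of $\Gamma$ with finitely many orbits, then $G$ is compactly generated. (ii) If $B$ and $H$ are compactly presented, and $H$ acts on the vertices of $\Gamma$ with compactly generated stabilisers and acts on the vertices and edges of $\Gamma$ with finitely many orbits, then $G$ is compactly presented.
   Context: Graph-wreath product: let $V$ be the vertex set of $\Gamma$. The polyhedral product $B^{\Gamma,A}$ is, as an abstract group, the free product of the direct product $A^V$ and copies $B_v$ of $B$, one for each $v\in V$, subject to: (1) if $(a_v)\in A^V$ has $a_v=1$ for all $v\ne w$, then $(a_v)$ is identified with $a_w\in B_w$; (2) if $(a_v)\in A^V$ has $a_w=1$ and $g\in B_w$, then $g$ commutes with $(a_v)$; (3) if $v_1,v_2$ are joined by an edge of $\Gamma$, then $B_{v_1}$ and $B_{v_2}$ commute elementwise. There is a unique t.d.l.c. group topology on $B^{\Gamma,A}$ in which $A^V$ (with its profinite product topology) is a compact open subgroup. $H$ acts on $B^{\Gamma,A}$ by permuting the copies of $B$ through its action on $\Gamma$, and the graph-wreath product is the semidirect product $B^{\Gamma,A}\rtimes H$ with the unique t.d.l.c. topology making it a topological semidirect product. A t.d.l.c. group is compactly presented if there is a finite connected graph of profinite groups $(\mathcal{A},\Lambda)$ and a continuous open epimorphism $\phi\colon\pi_1(\mathcal{A},\Lambda)\to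 G$, injective on every vertex group, whose kernel is finitely generated as a normal subgroup. Equivalently, it has, as an abstract group, a presentation $\langle S\mid \mathcal{R}\rangle$ with $S$ a compact generating set and $\mathcal{R}$ a set of relators of bounded length. *)

(* Defs.v *)
From HB Require Import structures.
From mathcomp Require Import all_boot.
From mathcomp Require Import all_classical all_reals all_analysis.

Set Implicit Arguments.
Unset Strict Implicit.
Unset Printing Implicit Defensive.

Local Open Scope classical_set_scope.
Local Open Scope group_scope.

HB.mixin Record isTopologicalGroup G of Group G & Topological G := {
  mulg_continuous : continuous (fun x : G * G => x.1 * x.2);
  invg_continuous : continuous (fun x : G => x^-1)
}.

#[short(type="topGroupType")]
HB.structure Definition TopologicalGroup :=
  {G of Group G & Topological G & isTopologicalGroup G}.

Definition tdlc (G : topGroupType) : Prop :=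
  [/\ hausdorff_space G, totally_disconnected [set: G]
    & locally_compact [set: G]].

Definition profinite (G : topGroupType) : Prop :=
  [/\ hausdorff_space G, totally_disconnected [set: G] & compact [set: G]].

Section Subgroups.
Variable G : groupType.
Implicit Types K X : set G.

Definition subgroup K : Prop :=
  K 1 /\ forall x y, K x -> K y -> K (x / y).

Definition normal_subgroup K : Prop :=
  subgroup K /\ forall x g, K x -> K (x ^ g).

Definition subgroup_generated X : set G := smallest subgroup X.

Definition normal_closure X : set G := smallest normal_subgroup X.

End Subgroups.

(* For a subgroup K of a topological group: compactness of X in the subspace
   topology of K is the same as compactness in G. *)
Definition compactly_generated (G : topGroupType) (K : set G) : Prop :=
  exists2 X : set G, compact X & subgroup_generated X = K.

Definition open_map (X Y : topologicalType) (f : X -> Y) : Prop :=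
  forall U : set X, open U -> open (f @` U).

Section GroupPresentation.
Variable S : choiceType.

(* The letter (s, false) stands for the generator s, (s, true) for s^-1. *)
Definition word := seq (S * bool).

Definition gen (s : S) : S * bool := (s, false).
Definition inv_letter (x : S * bool) : S * bool := (x.1, ~~ x.2).
Definition inv_word (u : word) : word := rev (map inv_letter u).

(* R u v is the defining relation u = v. *)
Variable R : word -> word -> Prop.

Inductive word_eq : word -> word -> Prop :=
| word_eq_refl u : word_eq u u
| word_eq_sym u v : word_eq u v -> word_eq v u
| word_eq_trans u v w : word_eq u v -> word_eq v w -> word_eq u w
| word_eq_cat u u' v v' :
    word_eq u u' -> word_eq v v' -> word_eq (u ++ v) (u' ++ v')
| word_eq_cancel x : word_eq [:: x; inv_letter x] [::]
| word_eq_rel u v : R u v -> word_eq u v.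

Let word_eqb : rel word := fun u v => `[< word_eq u v >].

Let word_eqb_refl : reflexive word_eqb.
Proof. by move=> u; apply/asboolP; exact: word_eq_refl. Qed.

Let word_eqb_sym : symmetric word_eqb.
Proof.
by move=> u v; apply/asboolP/asboolP => ?; exact: word_eq_sym.
Qed.

Let word_eqb_trans : transitive word_eqb.
Proof.
move=> v u w /asboolP uv /asboolP vw; apply/asboolP.
exact: word_eq_trans uv vw.
Qed.

Definition word_equiv : equiv_rel word :=
  EquivRel word_eqb word_eqb_refl word_eqb_sym word_eqb_trans.

Local Open Scope quotient_scope.

Definition presented_group : Type := {eq_quot word_equiv}.

HB.instance Definition _ := Choice.on presented_group.
HB.instance Definition _ := EqQuotient.on presented_group.

Definition pres_word (u : word) : presented_group := \pi_presented_group u.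

Definition pres_gen (s : S) : presented_group := pres_word [:: gen s].

Lemma pres_wordP u v : pres_word u = pres_word v <-> word_eq u v.
Proof.
split=> [/eqmodP/asboolP//|uv].
by apply/eqmodP/asboolP.
Qed.

Lemma pres_word_surj (x : presented_group) : exists u, pres_word u = x.
Proof. by exists (repr x); rewrite /pres_word reprK. Qed.

Lemma inv_letterK : involutive inv_letter.
Proof. by case=> s b; rewrite /inv_letter /= negbK. Qed.

Lemma inv_wordV u : word_eq (inv_word u ++ u) [::].
Proof.
elim: u => [|x u IHu]; first exact: word_eq_refl.
rewrite /inv_word /= rev_cons -cats1 -catA /=.
have -> : [:: inv_letter x, x & u] = [:: inv_letter x; x] ++ u by [].
apply: word_eq_trans IHu; apply: word_eq_cat; first exact: word_eq_refl.
rewrite -[X in word_eq _ X]cat0s; apply: word_eq_cat (word_eq_refl _).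
by have := word_eq_cancel (inv_letter x); rewrite inv_letterK.
Qed.

Lemma inv_wordK : involutive inv_word.
Proof.
move=> u; rewrite /inv_word map_rev revK -map_comp.
by rewrite -[RHS]map_id; apply: eq_map => x /=; rewrite inv_letterK.
Qed.

Lemma inv_wordVr u : word_eq (u ++ inv_word u) [::].
Proof. by rewrite -{1}[u]inv_wordK; exact: inv_wordV. Qed.

Lemma inv_word_eq u v : word_eq u v -> word_eq (inv_word u) (inv_word v).
Proof.
move=> uv; have l : word_eq (inv_word u) (inv_word u ++ (v ++ inv_word v)).
  rewrite -{1}[inv_word u]cats0; apply: word_eq_cat (word_eq_refl _) _.
  exact: word_eq_sym (inv_wordVr v).
apply: word_eq_trans l _; rewrite catA -{2}[inv_word v]cat0s.
apply: word_eq_cat (word_eq_refl _).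
apply: word_eq_trans (inv_wordV u).
apply: word_eq_cat; first exact: word_eq_refl.
exact: word_eq_sym.
Qed.

Definition pres_mul (x y : presented_group) : presented_group :=
  pres_word (repr x ++ repr y).
Definition pres_one : presented_group := pres_word [::].
Definition pres_inv (x : presented_group) : presented_group :=
  pres_word (inv_word (repr x)).

Lemma repr_pres_word u : word_eq (repr (pres_word u)) u.
Proof. by apply/pres_wordP; rewrite /pres_word reprK. Qed.

Lemma pres_mulE u v : pres_mul (pres_word u) (pres_word v) = pres_word (u ++ v).
Proof. by apply/pres_wordP; apply: word_eq_cat; exact: repr_pres_word. Qed.

Lemma pres_invE u : pres_inv (pres_word u) = pres_word (inv_word u).
Proof. by apply/pres_wordP; apply: inv_word_eq; exact: repr_pres_word. Qed.

Lemma pres_mulA : associative pres_mul.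
Proof.
move=> x y z; have [u <-] := pres_word_surj x.
have [v <-] := pres_word_surj y; have [w <-] := pres_word_surj z.
by rewrite !pres_mulE catA.
Qed.

Lemma pres_mul1 : left_id pres_one pres_mul.
Proof. by move=> x; have [u <-] := pres_word_surj x; rewrite pres_mulE. Qed.

Lemma pres_mulr1 : right_id pres_one pres_mul.
Proof.
by move=> x; have [u <-] := pres_word_surj x; rewrite pres_mulE cats0.
Qed.

Lemma pres_mulV : left_inverse pres_one pres_inv pres_mul.
Proof.
move=> x; have [u <-] := pres_word_surj x.
by rewrite pres_invE pres_mulE; apply/pres_wordP; exact: inv_wordV.
Qed.

Lemma pres_mulVr : right_inverse pres_one pres_inv pres_mul.
Proof.
move=> x; have [u <-] := pres_word_surj x.
by rewrite pres_invE pres_mulE; apply/pres_wordP; exact: inv_wordVr.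
Qed.

HB.instance Definition _ := isGroup.Build presented_group
  pres_mulA pres_mul1 pres_mulr1 pres_mulV pres_mulVr.

End GroupPresentation.

(* The finite graph is given with an orientation: gedge lists one oriented
   edge for each geometric edge, so the edge group is attached to the
   geometric edge and no identification of the groups of an edge and of its
   inverse is needed. The edge maps of a graph of profinite groups are open
   embeddings; this is what makes its fundamental group a t.d.l.c. group. *)
Record profinite_graph := ProfiniteGraph {
  gvert : finType;
  gedge : finType;
  gsrc : gedge -> gvert;
  gtgt : gedge -> gvert;
  vgroup : gvert -> topGroupType;
  egroup : gedge -> topGroupType;
  src_map : forall e, egroup e -> vgroup (gsrc e);
  tgt_map : forall e, egroup e -> vgroup (gtgt e);
  vgroup_profinite : forall v, profinite (vgroup v);
  egroup_profinite : forall e, profinite (egroup e);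
  src_mapM : forall e, {morph @src_map e : x y / x * y};
  tgt_mapM : forall e, {morph @tgt_map e : x y / x * y};
  src_map_inj : forall e, injective (@src_map e);
  tgt_map_inj : forall e, injective (@tgt_map e);
  src_map_continuous : forall e, continuous (@src_map e);
  tgt_map_continuous : forall e, continuous (@tgt_map e);
  src_map_open : forall e, open_map (@src_map e);
  tgt_map_open : forall e, open_map (@tgt_map e)
}.

Section FundamentalGroup.
Variable L : profinite_graph.

(* (e, true) is e traversed backwards. *)
Definition origin (x : gedge L * bool) : gvert L :=
  if x.2 then gtgt x.1 else gsrc x.1.
Definition terminus (x : gedge L * bool) : gvert L :=
  if x.2 then gsrc x.1 else gtgt x.1.
Definition edge_rev (x : gedge L * bool) : gedge L * bool := (x.1, ~~ x.2).

Definition edges_connected (T : {set gedge L}) : Prop :=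
  (0 < #|gvert L|)%N /\
  forall v w : gvert L,
    connect [rel a b | [exists x : gedge L * bool,
      [&& x.1 \in T, origin x == a & terminus x == b]]] v w.

(* A closed path without backtracking (also cyclically) through pairwise
   distinct vertices; a loop is a circuit of length 1. *)
Definition circuit (c : seq (gedge L * bool)) : bool :=
  [&& c != [::],
      cycle [rel x y | (terminus x == origin y) && (y != edge_rev x)] c
    & uniq (map origin c)].

Definition spanning_tree (T : {set gedge L}) : Prop :=
  edges_connected T /\
  forall c, circuit c -> ~ all (fun x => x.1 \in T) c.

Definition pi1_generators : choiceType :=
  ({v : gvert L & vgroup v} + gedge L)%type.

Definition vert (v : gvert L) (a : vgroup v) : pi1_generators * bool :=
  @gen pi1_generators (inl (existT _ v a)).
Definition stable (e : gedge L) : pi1_generators * bool := @gen pi1_generators (inr e).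

Inductive pi1_relation (T : {set gedge L}) :
    word pi1_generators -> word pi1_generators -> Prop :=
| pi1_vgroup v (a b : vgroup v) :
    pi1_relation T [:: vert a; vert b] [:: vert (a * b)]
| pi1_edge e (c : egroup e) :
    pi1_relation T [:: stable e; vert (tgt_map c); inv_letter (stable e)]
                   [:: vert (src_map c)]
| pi1_tree e : e \in T -> pi1_relation T [:: stable e] [::].

Definition pi1 (T : {set gedge L}) : Type := presented_group (pi1_relation T).

HB.instance Definition _ T := Group.on (pi1 T).

Definition pi1_vgroup_map T (v : gvert L) (a : vgroup v) : pi1 T :=
  pres_gen (pi1_relation T) (inl (existT _ v a)).

(* The group topology of the fundamental group in which the vertex groups are
   open subgroups carrying their own topology: a set is open when each of its
   left translates meets every vertex group in an open subset. *)
Definition pi1_open T (U : set (pi1 T)) : Prop :=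
  forall (x : pi1 T) v,
    open [set a : vgroup v | U (x * pi1_vgroup_map T a)].

Lemma pi1_openT T : @pi1_open T setT.
Proof. by move=> x v; exact: openT. Qed.

Lemma pi1_openI T : setI_closed (@pi1_open T).
Proof. by move=> U W oU oW x v; exact: openI (oU x v) (oW x v). Qed.

Lemma pi1_open_bigU T (I : Type) (f : I -> set (pi1 T)) :
  (forall i, pi1_open (f i)) -> pi1_open (\bigcup_i f i).
Proof.
move=> of_ x v.
rewrite (_ : mkset _ =
  \bigcup_i [set a : vgroup v | f i (x * pi1_vgroup_map T a)]) //.
by apply: bigcup_open => i _; exact: of_.
Qed.

HB.instance Definition _ T := isOpenTopological.Build (pi1 T)
  (@pi1_openT T) (@pi1_openI T) (@pi1_open_bigU T).

Lemma pi1_openE T (U : set (pi1 T)) : open U = pi1_open U.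
Proof. by []. Qed.

End FundamentalGroup.

Definition compactly_presented (G : topGroupType) : Prop :=
  exists (L : profinite_graph) (T : {set gedge L}) (phi : pi1 T -> G)
         (F : set (pi1 T)),
    edges_connected [set: gedge L]%SET /\ spanning_tree T /\
    {morph phi : x y / x * y} /\ continuous phi /\ open_map phi /\
    set_surj [set: pi1 T] [set: G] phi /\
    (forall v, injective (fun a : vgroup v => phi (pi1_vgroup_map T a))) /\
    finite_set F /\ [set x | phi x = 1] = normal_closure F.

Section PolyhedralProduct.
Variables (B : topGroupType) (A : set B) (V : choiceType) (adj : rel V).

Definition pp_generators : choiceType := ((V -> A) + V * B)%type.

Definition base (a : V -> A) : pp_generators * bool := @gen pp_generators (inl a).
Definition copy (v : V) (g : B) : pp_generators * bool :=
  @gen pp_generators (inr (v, g)).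

Inductive pp_relation : word pp_generators -> word pp_generators -> Prop :=
| pp_base_mul (a b c : V -> A) :
    (forall v, \val (c v) = \val (a v) * \val (b v)) ->
    pp_relation [:: base a; base b] [:: base c]
| pp_copy_mul v (g h : B) :
    pp_relation [:: copy v g; copy v h] [:: copy v (g * h)]
| pp_base_copy (a : V -> A) w :
    (forall v, v != w -> \val (a v) = 1) ->
    pp_relation [:: base a] [:: copy w (\val (a w))]
| pp_base_comm (a : V -> A) w (g : B) :
    \val (a w) = 1 ->
    pp_relation [:: copy w g; base a] [:: base a; copy w g]
| pp_adj_comm v w (g h : B) : adj v w ->
    pp_relation [:: copy v g; copy w h] [:: copy w h; copy v g].

Definition polyhedral_product : groupType := presented_group pp_relation.

Definition pp_base (a : V -> A) : polyhedral_product :=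
  pres_gen pp_relation (inl a).

Definition pp_copy (v : V) (g : B) : polyhedral_product :=
  pres_gen pp_relation (inr (v, g)).

(* P, via the isomorphism e, is the polyhedral product with its t.d.l.c. group
   topology: A^V with its product topology is embedded as an open (and, by
   Tychonoff, compact) subgroup. *)
Definition is_topological_polyhedral_product
    (P : topGroupType) (e : polyhedral_product -> P) : Prop :=
  [/\ tdlc P, {morph e : x y / x * y} & bijective e] /\
  [/\ injective (e \o pp_base),
      continuous (e \o pp_base : {ptws V -> A} -> P)
    & open_map (e \o pp_base : {ptws V -> A} -> P)].

End PolyhedralProduct.

Definition simple_graph (V : Type) (adj : rel V) : Prop :=
  symmetric adj /\ irreflexive adj.

Definition edges (V : Type) (adj : rel V) : set (set V) :=
  [set E | exists v w, adj v w /\ E = [set v; w]].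

Definition graph_action (H : groupType) (V : Type) (adj : rel V)
    (act : H -> V -> V) : Prop :=
  [/\ forall v, act 1 v = v,
      forall g h v, act (g * h) v = act g (act h v)
    & forall h v w, adj (act h v) (act h w) = adj v w].

Definition continuous_action (H : topGroupType) (V : topologicalType)
    (act : H -> V -> V) : Prop :=
  continuous (fun x : H * V => act x.1 x.2).

Definition stabiliser (H V : Type) (act : H -> V -> V) (v : V) : set H :=
  [set h | act h v = v].

Definition finitely_many_orbits (H X : Type) (act : H -> X -> X) (D : set X) :
    Prop :=
  finite_set [set range (act^~ x) | x in D].

Definition edge_action (H V : Type) (act : H -> V -> V) (h : H) (E : set V) :
    set V :=
  act h @` E.

(* G is the internal topological semidirect product of i(P) and j(H), where P
   is the polyhedral product and conjugation by j(h) permutes the copies of B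
   and the coordinates of A^V according to the action of h on the vertices. *)
Definition is_graph_wreath_product (B H : topGroupType) (A : set B)
    (V : choiceType) (adj : rel V) (act : H -> V -> V) (G : topGroupType) :
    Prop :=
  exists (P : topGroupType) (e : polyhedral_product A adj -> P)
         (i : P -> G) (j : H -> G),
    is_topological_polyhedral_product e /\ tdlc G /\
    {morph i : x y / x * y} /\ {morph j : x y / x * y} /\
    (forall h v g,
       j h * i (e (pp_copy A adj v g)) * (j h)^-1 =
       i (e (pp_copy A adj (act h v) g))) /\
    (forall h (a : V -> A),
       j h * i (e (pp_base adj a)) * (j h)^-1 =
       i (e (pp_base adj (fun v => a (act h^-1 v))))) /\
    let f := fun x : P * H => i x.1 * j x.2 in
    bijective f /\ continuous f /\ open_map f.

(* Main.v *)
From HB Require Import structures.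
Require Import Defs.
From mathcomp Require Import all_boot.
From mathcomp Require Import all_classical all_reals all_analysis.

(** The graph-wreath product G is generated by the image of A^V, by H and by one
    copy of B for each orbit of vertices, because conjugation by H carries the
    copy at v to the copy at h v. These are finitely many compactly generated
    pieces together with the compact set A^V, which proves (i).

    For (ii), compact presentability is restated as a universal property that
    does not mention graphs of groups. Call f : G -> Q, with Q an abstract
    group, partially multiplicative on C if f (x y) = f x f y whenever x, y and
    x y lie in C. Then G is [boundedly_presented] when there are a compact C
    and a compact generating set D, containing a compact open subgroup, such
    that every map partially multiplicative on C agrees on D with a
    homomorphism. This says that the multiplication table of a compact set
    presents G, that is, that relators of bounded length suffice.

    Bounded presentability implies compact presentability
    ([boundedly_presented_compactly]). Let U be the compact open subgroup and
    cover D by the cosets s_i U, for finitely many s_i. The graph of groups has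
    one vertex, with group U, and one loop for each s_i, with group
    U & s_i^-1 U s_i, whose two images in U are open, hence of finite index.
    Hence U is commensurated by its fundamental group E, and the subsets of E
    covered by finitely many left cosets of U are closed under products and
    inverses. The map phi : E -> G is injective on U, so that a left coset of U
    holds at most one element of the kernel; the kernel meets every such subset
    in a finite set. Choose such a K with C inside phi(K). Modulo the finite
    set of elements of K^-1 K K in the kernel, phi(k) |-> class of k is well
    defined and partially multiplicative on C, so it extends to G, and the
    extension inverts the map to G: these finitely many elements generate the
    kernel as a normal subgroup.

    Conversely ([compactly_boundedly_presented]), a partially multiplicative
    map on a large enough compact set respects the relations of the graph of
    groups, hence lifts to a homomorphism of its fundamental group, and it
    kills the finitely many generators of the kernel as soon as the compact set
    contains the partial products of words that represent them. This last point
    is the theme of [locally_determined] sets. A vertex group has open image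
    because, along the edges of the spanning tree, it meets every other vertex
    group in an open subgroup.

    It remains to show that bounded presentability passes from B and H to G
    ([wreath_extension]). A partially multiplicative f restricts to partially
    multiplicative maps on H and on the copies of B at representatives of the
    orbits of vertices, which extend to homomorphisms gH and gB. The
    homomorphism on the copy at v = h r is forced to be gH(h) gB(r) gH(h)^-1.
    It does not depend on h because gH of the stabiliser of r commutes with
    gB(r), and this needs checking only on compact generating sets. In the same
    way every defining relation of the polyhedral product is reduced, by
    conjugation, to finitely many orbits and then, by generation, to identities
    x y = z w between elements of one compact set C1. Such an identity survives
    under f as soon as f is partially multiplicative on C1 and C1 C1. *)

Set Implicit Arguments.
Unset Strict Implicit.
Unset Printing Implicit Defensive.

Local Open Scope classical_set_scope.
Local Open Scope group_scope.

(** * Groups, subgroups and presentations *)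

Section Homomorphisms.
Variables (G K : groupType) (f : G -> K).
Hypothesis fM : {morph f : x y / x * y}.

Lemma morph1 : f 1 = 1.
Proof. by apply: (@mulgI _ (f 1)); rewrite -fM !mulg1. Qed.

Lemma morphV x : f x^-1 = (f x)^-1.
Proof. by apply: (@mulgI _ (f x)); rewrite -fM !mulgV morph1. Qed.

Lemma kernel_normal_subgroup : normal_subgroup [set x | f x = 1].
Proof.
split; first split=> [|x y /= fx fy]; rewrite /= ?morph1 //.
  by rewrite fM morphV fx fy invg1 mulg1.
by move=> x g /= fx; rewrite conjgE !fM fx mul1g morphV mulVg.
Qed.

End Homomorphisms.

Lemma morph_comp (G K L : groupType) (f : G -> K) (g : K -> L) :
  {morph f : x y / x * y} -> {morph g : x y / x * y} ->
  {morph g \o f : x y / x * y}.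
Proof. by move=> fM gM x y /=; rewrite fM gM. Qed.

Section SubgroupTheory.
Variable G : groupType.
Implicit Types (K X : set G).

Lemma subgroupV K x : subgroup K -> K x -> K x^-1.
Proof. by move=> [K1 KF] Kx; rewrite -[x^-1]mul1g; exact: KF. Qed.

Lemma subgroupM K x y : subgroup K -> K x -> K y -> K (x * y).
Proof.
move=> sK Kx Ky; rewrite -[y]invgK; apply: (sK.2) => //.
exact: subgroupV.
Qed.

Lemma subgroupI K1 K2 : subgroup K1 -> subgroup K2 -> subgroup (K1 `&` K2).
Proof.
move=> [a1 aF] [b1 bF]; split=> // x y [ax bx] [ay yb].
by split; [exact: aF | exact: bF].
Qed.

Lemma subgroup_conj K g : subgroup K -> subgroup [set x | K (g * x * g^-1)].
Proof.
move=> sK; split=> [|x y /= Kx Ky]; first by rewrite /= mulg1 mulgV; exact: sK.1.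
have -> : g * (x / y) * g^-1 = (g * x * g^-1) / (g * y * g^-1).
  by rewrite !invgM invgK !mulgA mulgVK.
exact: sK.2.
Qed.

Lemma subset_generated X : X `<=` subgroup_generated X.
Proof. by move=> x Xx K [_]; exact. Qed.

Lemma generated_min X K :
  subgroup K -> X `<=` K -> subgroup_generated X `<=` K.
Proof. by move=> sK XK x; apply; split. Qed.

Lemma generated_subgroup X : subgroup (subgroup_generated X).
Proof.
split=> [K [[]] // | x y Xx Xy K KX].
by apply: KX.1.2; [exact: Xx | exact: Xy].
Qed.

Lemma normal_closureP X : normal_subgroup (normal_closure X).
Proof.
split; first split=> [K [[[]]] // | x y Xx Xy K KX].
  by apply: KX.1.1.2; [exact: Xx | exact: Xy].
by move=> x g Xx K KX; apply: KX.1.2; exact: Xx.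
Qed.

Lemma subset_normal_closure X : X `<=` normal_closure X.
Proof. by move=> x Xx K [_]; exact. Qed.

Lemma normal_closure_min X K :
  normal_subgroup K -> X `<=` K -> normal_closure X `<=` K.
Proof. by move=> nK XK x; apply; split. Qed.

End SubgroupTheory.

Section PresentedGroups.
Variables (S : choiceType) (R : word S -> word S -> Prop).

Lemma pres_word_cat u v : pres_word R (u ++ v) = pres_word R u * pres_word R v.
Proof. by rewrite -pres_mulE. Qed.

Lemma pres_word0 : pres_word R [::] = 1.
Proof. by []. Qed.

Lemma pres_wordV u : pres_word R (inv_word u) = (pres_word R u)^-1.
Proof. by rewrite -pres_invE. Qed.

Lemma pres_word_gen s b :
  pres_word R [:: (s, b)] = if b then (pres_gen R s)^-1 else pres_gen R s.
Proof. by case: b => //; rewrite /pres_gen -pres_wordV. Qed.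

Lemma pres_word_rel u v : R u v -> pres_word R u = pres_word R v.
Proof. by move=> Ruv; apply/pres_wordP; exact: word_eq_rel. Qed.

Lemma presented_group_ind (K : set (presented_group R)) :
  subgroup K -> (forall s, K (pres_gen R s)) -> forall x, K x.
Proof.
move=> sK Kgen x; have [u <-] := pres_word_surj x.
elim: u => [|[s b] u IHu]; first by rewrite pres_word0; exact: sK.1.
rewrite -cat1s pres_word_cat; apply: subgroupM => //.
by rewrite pres_word_gen; case: b => //; apply: subgroupV.
Qed.

Variables (Q : groupType) (h : S -> Q).

Definition word_value (u : word S) : Q :=
  \prod_(x <- u) (if x.2 then (h x.1)^-1 else h x.1).

Lemma word_value_cat u v : word_value (u ++ v) = word_value u * word_value v.
Proof. by rewrite /word_value big_cat. Qed.

Hypothesis hR : forall u v, R u v -> word_value u = word_value v.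

Lemma word_value_eq u v : word_eq R u v -> word_value u = word_value v.
Proof.
elim=> // {u v} [u v w _ -> _ ->|u u' v v' _ IHu _ IHv|[s b]] //.
  by rewrite !word_value_cat IHu IHv.
rewrite /word_value big_cons big_seq1 big_nil /=.
by case: b; rewrite ?mulgV ?mulVg.
Qed.

Lemma presented_group_lift :
  exists2 f : presented_group R -> Q,
    {morph f : x y / x * y} & forall s, f (pres_gen R s) = h s.
Proof.
pose f (x : presented_group R) := word_value (repr x).
have fE u : f (pres_word R u) = word_value u.
  by apply: word_value_eq; exact: repr_pres_word.
exists f => [x y|s]; last by rewrite fE /word_value big_seq1.
have [u <-] := pres_word_surj x; have [v <-] := pres_word_surj y.
by rewrite -pres_word_cat !fE word_value_cat.
Qed.

End PresentedGroups.

(** The quotient of a presented group by the normal closure of F is presented by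
    adding, as relators, all the words that represent elements of F. *)
Section QuotientByNormalClosure.
Variables (S : choiceType) (R : word S -> word S -> Prop).
Variable F : set (presented_group R).

Let R' u v := R u v \/ F (pres_word R u) /\ v = [::].

Lemma word_eq_normal_closure u v : word_eq R' u v ->
  normal_closure F (pres_word R u / pres_word R v).
Proof.
have [sN nN] := normal_closureP F.
elim=> {u v} [u|u v _|u v w _ IHu _ IHv|u u' v v' _ IHu _ IHv|x|u v].
- by rewrite mulgV; exact: sN.1.
- by move=> /(subgroupV sN); rewrite invgF.
- by have := subgroupM sN IHu IHv; rewrite mulgA mulgVK.
- rewrite !pres_word_cat invgM.
  have := subgroupM sN (nN _ (pres_word R u)^-1 IHv) IHu.
  by rewrite conjgE invgK !mulgA mulgVK.
- rewrite (_ : pres_word R _ = 1) ?divg1; first exact: sN.1.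
  by rewrite -pres_word0; apply/pres_wordP; exact: word_eq_cancel.
move=> [/pres_word_rel ->|[Fu ->]]; first by rewrite mulgV; exact: sN.1.
by rewrite pres_word0 divg1; exact: subset_normal_closure.
Qed.

Lemma quotient_by_normal_closure :
  exists (Q : groupType) (q : presented_group R -> Q),
    {morph q : x y / x * y} /\ forall x, q x = 1 <-> normal_closure F x.
Proof.
have [|q qM qgen] := @presented_group_lift S R
    (presented_group R' : groupType) (pres_gen R').
  have val u : word_value (pres_gen R' : S -> (presented_group R' : groupType)) u
      = pres_word R' u.
    elim: u => [|[s b] u IHu]; first by rewrite /word_value big_nil.
    by rewrite /word_value big_cons -/(word_value _ u) IHu -[_ :: u]cat1s
      pres_word_cat pres_word_gen.
  by move=> u v Ruv; rewrite !val; apply: pres_word_rel; left.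
have qE u : q (pres_word R u) = pres_word R' u.
  elim: u => [|[s b] u IHu]; first by rewrite pres_word0 (morph1 qM).
  rewrite -cat1s !pres_word_cat qM IHu !pres_word_gen.
  by case: b; rewrite ?(morphV qM) qgen.
exists (presented_group R' : groupType), q; split=> // x; split.
  have [u <-] := pres_word_surj x; rewrite qE -pres_word0 => /pres_wordP.
  by move=> /word_eq_normal_closure; rewrite pres_word0 divg1.
apply: (normal_closure_min (kernel_normal_subgroup qM)) => {}x /=.
have [u <-] := pres_word_surj x => Fu.
by rewrite qE -pres_word0; apply: pres_word_rel; right.
Qed.

End QuotientByNormalClosure.

(** * Compact sets and topological groups *)
Section CompactSets.

Lemma compact_image (X Y : topologicalType) (f : X -> Y) (K : set X) :
  continuous f -> compact K -> compact (f @` K).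
Proof. by move=> cf; apply: continuous_compact; exact: continuous_subspaceT. Qed.

Lemma compact_bigcup (I : choiceType) (T : topologicalType) (D : set I)
    (F : I -> set T) :
  finite_set D -> (forall i, D i -> compact (F i)) ->
  compact (\bigcup_(i in D) F i).
Proof.
move=> finD cF; rewrite -bigsetU_fset_set //.
rewrite big_seq_cond; apply: bigsetU_compact => i; rewrite andbT.
by rewrite in_fset_set // inE => /cF.
Qed.

(** Finite subcovers come from the near-covering property, applied to the filter
    of finite sequences ordered by inclusion: for y near x, eventually the
    sequence contains x, whose chosen neighbourhood contains y. *)
Lemma compact_finite_cover (T : topologicalType) (X : set T) (N : T -> set T) :
  compact X -> (forall x, X x -> nbhs x (N x)) ->
  exists2 s : seq T, (forall y, y \in s -> X y)
    & forall x, X x -> exists2 y, y \in s & N y x.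
Proof.
move=> /compact_near_coveringP cX nN.
pose P (s : seq T) x := exists2 y, y \in s & X y /\ N y x.
pose F := filter_from [set: seq T] (fun s => [set s' : seq T | {subset s <= s'}]).
have FF : Filter F.
  apply: filter_from_filter; first by exists [::].
  move=> s t _ _; exists (s ++ t) => // s' /= sub.
  by split=> x xs; apply: sub; rewrite mem_cat xs ?orbT.
have [x Xx|s _ /(_ s (fun _ => id)) cov] := cX _ F P FF.
  exists (N x, [set s' : seq T | {subset [:: x] <= s'}]) => /=.
    by split; [exact: nN | exists [:: x]].
  move=> [y s'] /= [Ny xs']; exists x; first by apply: xs'; rewrite inE.
  by split.
exists [seq y <- s | `[< X y >]].
  by move=> y; rewrite mem_filter => /andP[/asboolP].
move=> x /cov[y ys [Xy Ny]]; exists y => //.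
by rewrite mem_filter ys andbT; apply/asboolP.
Qed.

Lemma compact_set_type (T : topologicalType) (K : set T) :
  compact K -> compact [set: K].
Proof.
move=> cK F PF _.
have [|x [Kx clx]] := cK ((@set_val T K) @ F) _.
  apply: (@filterS _ F _ setT); last exact: filterT.
  by move=> y _; exact: set_valP.
exists (exist _ x (mem_set Kx)); split=> // A B FA [_ [[V oV <-] Vx VB]].
have [||_ [[z Az <-] Vz]] := clx ((@set_val T K) @` A) V.
- by apply: (@filterS _ F _ A) FA => z Az; exists z.
- by apply: open_nbhs_nbhs; split.
by exists z; split=> //; exact: VB.
Qed.

End CompactSets.

Section Translations.
Variable G : topGroupType.
Implicit Types (x y : G) (K U X Y : set G).

Lemma cvg_mulg (T : topologicalType) (f g : T -> G) :
  continuous f -> continuous g -> continuous (fun t => f t * g t).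
Proof.
move=> cf cg t; apply: (@continuous_comp T (G * G)%type G
  (fun t => (f t, g t)) (fun p => p.1 * p.2)).
  by apply: cvg_pair; [exact: cf | exact: cg].
exact: mulg_continuous.
Qed.

Lemma lmul_continuous x : continuous (fun y => x * y).
Proof. by apply: cvg_mulg => y; [exact: cvg_cst | exact: cvg_id]. Qed.

Lemma conj_continuous x : continuous (fun y => x * y * x^-1).
Proof.
apply: cvg_mulg; first exact: lmul_continuous.
by move=> y; exact: cvg_cst.
Qed.

Lemma open_lmul x U : open U -> open [set y | U (x * y)].
Proof. by move=> oU; apply: (open_comp _ oU) => y _; exact: lmul_continuous. Qed.

Lemma open_conj x U : open U -> open [set y | U (x * y * x^-1)].
Proof. by move=> oU; apply: (open_comp _ oU) => y _; exact: conj_continuous. Qed.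

Lemma compact_mulg X Y :
  compact X -> compact Y -> compact [set x * y | x in X & y in Y].
Proof.
move=> cX cY.
rewrite (_ : [set _ | _ in X & _ in Y] =
  (fun p : G * G => p.1 * p.2) @` (X `*` Y)).
  by apply: compact_image (compact_setX cX cY); exact: mulg_continuous.
apply/seteqP; split=> [_ [x Xx [y Yy <-]]|_ [[x y] [Xx Yy] <-]].
  by exists (x, y).
by exists x => //; exists y.
Qed.

Lemma compact_cosets X U : compact X -> open U -> U 1 ->
  exists2 s : seq G, (forall y, y \in s -> X y)
    & forall x, X x -> exists2 y, y \in s & U (y^-1 * x).
Proof.
move=> cX oU U1; apply: compact_finite_cover cX _ => x _.
apply: open_nbhs_nbhs; split; first exact: open_lmul.
by rewrite /= mulVg.
Qed.

End Translations.

(** Translations are homeomorphisms, so continuity at 1 moves to every point. *)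
Lemma morph_continuous1 (G K : topGroupType) (f : G -> K) :
  {morph f : x y / x * y} -> (forall W, nbhs 1 W -> nbhs 1 (f @^-1` W)) ->
  continuous f.
Proof.
move=> fM f1 x W Wfx.
have : nbhs 1 [set y | W (f x * y)].
  by apply: (@lmul_continuous K (f x) 1 W); rewrite mulg1.
move=> /f1 /= W1.
have : nbhs x [set y | W (f x * f (x^-1 * y))].
  apply: (@lmul_continuous G x^-1 x [set z | W (f x * f z)]).
  by rewrite mulVg.
by apply: filterS => y /=; rewrite -fM mulVKg.
Qed.

Section SubgroupType.
Variables (G : topGroupType) (K : set G) (sK : subgroup K).

(** The proof of [subgroup K] is a parameter of the type so that the group
    structure, which depends on it, can be found by inference. *)
Definition subgroup_type of subgroup K : Type := set_type K.
Local Notation T := (subgroup_type sK).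

HB.instance Definition _ := Topological.copy T (set_type K).

Definition subgroup_val : T -> G := @set_val G K.
Definition subgroup_elt (x : G) (Kx : K x) : T := exist _ x (mem_set Kx).

Lemma subgroup_valP (x : T) : K (subgroup_val x).
Proof. exact: set_valP. Qed.

Lemma subgroup_val_inj : injective subgroup_val.
Proof. exact: val_inj. Qed.

Let sub1 : T := subgroup_elt sK.1.
Let subM (x y : T) : T :=
  subgroup_elt (subgroupM sK (subgroup_valP x) (subgroup_valP y)).
Let subV (x : T) : T := subgroup_elt (subgroupV sK (subgroup_valP x)).

Let subMA : associative subM.
Proof. by move=> x y z; apply: subgroup_val_inj; exact: mulgA. Qed.
Let sub1M : left_id sub1 subM.
Proof. by move=> x; apply: subgroup_val_inj; exact: mul1g. Qed.
Let subM1 : right_id sub1 subM.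
Proof. by move=> x; apply: subgroup_val_inj; exact: mulg1. Qed.
Let subVM : left_inverse sub1 subV subM.
Proof. by move=> x; apply: subgroup_val_inj; exact: mulVg. Qed.
Let subMV : right_inverse sub1 subV subM.
Proof. by move=> x; apply: subgroup_val_inj; exact: mulgV. Qed.

HB.instance Definition _ := isGroup.Build T subMA sub1M subM1 subVM subMV.

Lemma subgroup_val_continuous : continuous subgroup_val.
Proof. exact: initial_continuous. Qed.

Lemma subgroup_type_continuous (X : topologicalType) (f : X -> T) :
  continuous (subgroup_val \o f) -> continuous f.
Proof.
move=> cf x W [_ [[V oV <-] Vfx VW]].
apply: filterS (VW) _; apply: (cf x V); exact: open_nbhs_nbhs.
Qed.

Let subM_continuous : continuous (fun x : T * T => x.1 * x.2).
Proof.
apply: subgroup_type_continuous.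
apply: (@cvg_mulg G _ (fun p : T * T => subgroup_val p.1)
  (fun p : T * T => subgroup_val p.2)) => p.
  by apply: continuous_comp; [exact: cvg_fst | exact: subgroup_val_continuous].
by apply: continuous_comp; [exact: cvg_snd | exact: subgroup_val_continuous].
Qed.

Let subV_continuous : continuous (fun x : T => x^-1).
Proof.
apply: subgroup_type_continuous => x.
apply: (@continuous_comp _ _ _ subgroup_val (fun y : G => y^-1)).
  exact: subgroup_val_continuous.
exact: invg_continuous.
Qed.

HB.instance Definition _ :=
  isTopologicalGroup.Build T subM_continuous subV_continuous.

Lemma open_subgroup_val : open K -> open_map subgroup_val.
Proof.
move=> oK _ [V oV <-]; rewrite (_ : _ @` _ = V `&` K); first exact: openI.
apply/seteqP; split=> [_ [x Vx <-]|x [Vx Kx]].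
  by split; [exact: Vx | exact: subgroup_valP].
by exists (subgroup_elt Kx).
Qed.

Lemma subgroup_type_profinite : hausdorff_space G ->
  totally_disconnected [set: G] -> compact K -> profinite T.
Proof.
move=> hG tdG cK; split.
- move=> x y xy; apply/subgroup_val_inj/hG => A B xA yB.
  have [||z [Az Bz]] := xy (subgroup_val @^-1` A) (subgroup_val @^-1` B).
  + exact: subgroup_val_continuous.
  + exact: subgroup_val_continuous.
  + by exists (subgroup_val z).
- move=> x _; apply/seteqP; split; last first.
    by move=> _ ->; exact: connected_component_refl.
  move=> y [C [Cx _ conC] Cy]; apply: subgroup_val_inj.
  have : connected_component [set: G] (subgroup_val x) (subgroup_val y).
    exists (subgroup_val @` C); last by exists y.
    split; [by exists x | by [] |].
    apply: (connected_continuous_connected conC).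
    exact/continuous_subspaceT/subgroup_val_continuous.
  by rewrite tdG.
- exact: compact_set_type.
Qed.

End SubgroupType.

(** * The fundamental group of a graph of profinite groups *)
Section FundamentalGroupTopology.
Variables (L : profinite_graph) (T : {set gedge L}).

Local Notation vmap := (@pi1_vgroup_map L T).

Definition pi1_stable (e : gedge L) : pi1 T :=
  @pres_gen (pi1_generators L) (pi1_relation T) (inr e).

Lemma pi1_vgroup_mapM v : {morph @pi1_vgroup_map L T v : a b / a * b}.
Proof.
move=> a b; have /pres_word_rel := @pi1_vgroup L T v a b.
by rewrite -[[:: _; _]]cat1s pres_word_cat.
Qed.

Lemma pi1_stableE e (c : egroup e) :
  pi1_stable e * vmap (tgt_map c) = vmap (src_map c) * pi1_stable e.
Proof.
have /pres_word_rel := @pi1_edge L T e c.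
rewrite -[[:: _, _ & _]]cat1s -[[:: _; inv_letter _]]cat1s !pres_word_cat.
rewrite !pres_word_gen /= => tu.
have <- : pi1_stable e * (vmap (tgt_map c) * (pi1_stable e)^-1) =
  vmap (src_map c) by exact: tu.
by rewrite mulgA mulgVK.
Qed.

Lemma pi1_stable_tree e : e \in T -> pi1_stable e = 1.
Proof. by move=> eT; have /pres_word_rel := @pi1_tree L T e eT. Qed.

Lemma pi1_ind (K : set (pi1 T)) : subgroup K ->
  (forall v (a : vgroup v), K (vmap a)) -> (forall e, K (pi1_stable e)) ->
  forall x, K x.
Proof.
move=> sK Kv Ke; apply: presented_group_ind => //.
by case=> [[v a]|e]; [exact: Kv | exact: Ke].
Qed.

Lemma pi1_lift (Q : groupType) (hv : forall v, vgroup v -> Q)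
    (he : gedge L -> Q) :
  (forall v, {morph @hv v : a b / a * b}) ->
  (forall e (c : egroup e),
    he e * hv _ (tgt_map c) = hv _ (src_map c) * he e) ->
  (forall e, e \in T -> he e = 1) ->
  exists2 theta : pi1 T -> Q, {morph theta : x y / x * y} &
    (forall v (a : vgroup v), theta (vmap a) = hv v a) /\
    (forall e, theta (pi1_stable e) = he e).
Proof.
move=> hvM hE hT.
pose h (x : pi1_generators L) : Q :=
  match x with inl va => hv _ (projT2 va) | inr e => he e end.
have [|theta thM thh] := @presented_group_lift _ (pi1_relation T) Q h; last first.
  exists theta => //; split=> [v a|e].
    exact: (thh (inl (existT _ v a))).
  exact: (thh (inr e)).
move=> _ _ [v a b|e c|e eT]; rewrite /word_value !big_cons !big_nil !mulg1 /=.
- by rewrite hvM.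
- by rewrite mulgA hE mulgK.
- exact: hT.
Qed.

Lemma pi1_vgroup_map_continuous v : continuous (@pi1_vgroup_map L T v).
Proof.
apply/continuousP => W oW; rewrite (_ : _ @^-1` _ = [set a | W (1 * vmap a)]).
  exact: (oW 1 v).
by apply/seteqP; split=> a /=; rewrite mul1g.
Qed.

Let near_vgroup v w :=
  nbhs 1 [set a : vgroup w | range (@pi1_vgroup_map L T v) (vmap a)].

(** A stable letter in the tree is trivial, so the two embeddings of the edge
    group agree in the fundamental group. An open part of one end that lies in
    the image of the group of v is pulled back to the edge group and pushed
    forward to an open part of the other end. *)
Lemma near_vgroup_edge v x : x.1 \in T ->
  near_vgroup v (origin x) -> near_vgroup v (terminus x).
Proof.
case: x => e b /= eT.
have et c : vmap (@tgt_map L e c) = vmap (@src_map L e c).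
  by have := pi1_stableE c; rewrite pi1_stable_tree // mul1g mulg1.
have transfer v1 v2 (f : egroup e -> vgroup v1) (g : egroup e -> vgroup v2) :
    {morph f : x y / x * y} -> {morph g : x y / x * y} ->
    continuous f -> open_map g -> (forall c, vmap (f c) = vmap (g c)) ->
    near_vgroup v v1 -> near_vgroup v v2.
  move=> fM gM cf og fg.
  rewrite /near_vgroup -(morph1 fM) => /cf; rewrite nbhsE => -[W [oW W1] sW].
  rewrite -(morph1 gM) nbhsE; exists (g @` W); first split; first exact: og.
    by exists 1.
  by move=> _ [c /sW /= + <-]; rewrite fg.
case: b => /=; rewrite /origin /terminus /=.
  apply: (transfer _ _ (@tgt_map L e) (@src_map L e)) => //.
  - exact: tgt_mapM.
  - exact: src_mapM.
  - exact: tgt_map_continuous.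
  - exact: src_map_open.
apply: (transfer _ _ (@src_map L e) (@tgt_map L e)) => //.
- exact: src_mapM.
- exact: tgt_mapM.
- exact: src_map_continuous.
- exact: tgt_map_open.
Qed.

(** Connectedness of T makes the image of the group of v contain a
    neighbourhood of 1 in each vertex group, and a subgroup that does so is
    open for the topology whose open sets are tested on translates. *)
Lemma pi1_vgroup_open v : edges_connected T -> open (range (@pi1_vgroup_map L T v)).
Proof.
move=> [_ conT].
have near w : near_vgroup v w.
  have /connectP[p] := conT v w.
  have : near_vgroup v v.
    by apply: (@filterS _ _ _ setT); [move=> a _; exists a | exact: filterT].
  move: {2 3 4}v => a na pap ->; elim: p a na pap => [|b p IHp] a na //=.
  move=> /andP[/existsP[x /and3P[xT /eqP xa /eqP xb]] pbp].
  apply: (IHp b) => //; rewrite -xb; apply: near_vgroup_edge => //.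
  by rewrite xa.
rewrite pi1_openE => x w; rewrite openE => a0 /= xa0.
have : nbhs a0 [set a | range (@pi1_vgroup_map L T v) (vmap (a0^-1 * a))].
  apply: (@lmul_continuous (vgroup w) a0^-1 a0
    [set a | range (@pi1_vgroup_map L T v) (vmap a)]).
  by rewrite mulVg; exact: near.
apply: filterS => a /= [b _ eb]; case: xa0 => b0 _ eb0.
exists (b0 * b) => //; rewrite pi1_vgroup_mapM eb eb0.
by rewrite -mulgA -pi1_vgroup_mapM mulVKg.
Qed.

End FundamentalGroupTopology.

(** * Finite unions of cosets of a commensurated subgroup *)
Section BoundedSets.
Variables (E : groupType) (H : set E).
Hypothesis sH : subgroup H.
Implicit Types (X Y Z : set E) (x y z : E).

Definition bounded Y :=
  exists s : seq E, forall y, Y y -> exists2 x, x \in s & H (x^-1 * y).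

Lemma bounded_sub Y Z : Y `<=` Z -> bounded Z -> bounded Y.
Proof. by move=> YZ [s sZ]; exists s => y /YZ /sZ. Qed.

Lemma bounded_bigcup (I : eqType) (s : seq I) (Y : I -> set E) :
  (forall i, bounded (Y i)) -> bounded [set y | exists2 i, i \in s & Y i y].
Proof.
move=> bY; elim: s => [|i s [t st]]; first by exists [::] => y [].
have [ti Yti] := bY i; exists (ti ++ t) => y [j].
rewrite inE => /orP[/eqP ->|js] Yy.
  by have [x xt Hx] := Yti y Yy; exists x; rewrite // mem_cat xt.
have [|x xt Hx] := st y; first by exists j.
by exists x; rewrite // mem_cat xt orbT.
Qed.

Lemma bounded_mulr Y : bounded Y -> bounded [set y * h | y in Y & h in H].
Proof.
move=> [s sY]; exists s => _ [y Yy [h Hh <-]].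
have [x xs Hx] := sY y Yy; exists x => //.
by rewrite mulgA; exact: subgroupM.
Qed.

Definition commensurates y := bounded [set h * y | h in H].

(** If h y lies in a H, then h y z lies in a (H z), and H z is again covered by
    finitely many cosets. *)
Lemma commensurates_mul y z :
  commensurates y -> commensurates z -> commensurates (y * z).
Proof.
move=> [s sy] [t tz]; exists [seq a * b | a <- s, b <- t] => _ [h Hh <-].
have [|a as_ Ha] := sy (h * y); first by exists h.
have [|b bt Hb] := tz (a^-1 * (h * y) * z); first by exists (a^-1 * (h * y)).
exists (a * b); first by apply/allpairsP; exists (a, b).
by move: Hb; rewrite invgM !mulgA.
Qed.

(** The inverse has to be included: H y may be a finite union of left cosets of
    H when H y^-1 is not. *)
Lemma commensurator_subgroup :
  subgroup [set y | commensurates y /\ commensurates y^-1].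
Proof.
split=> [|x y [cx cx'] [cy cy']].
  suff c1 : commensurates 1 by rewrite /= invg1.
  exists [:: 1] => _ [h Hh <-]; exists 1; first by rewrite inE.
  by rewrite invg1 mul1g mulg1.
by split; rewrite ?invgF; exact: commensurates_mul.
Qed.

Hypothesis comm : forall y, commensurates y.

Lemma bounded_mul Y Z :
  bounded Y -> bounded Z -> bounded [set y * z | y in Y & z in Z].
Proof.
move=> [s sY] [t tZ].
have bYz z : bounded [set y * z | y in Y].
  have [r rz] := comm z; exists [seq a * b | a <- s, b <- r] => _ [y Yy <-].
  have [a as_ Ha] := sY y Yy.
  have [|b br Hb] := rz (a^-1 * y * z); first by exists (a^-1 * y).
  exists (a * b); first by apply/allpairsP; exists (a, b).
  by move: Hb; rewrite invgM !mulgA.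
have := bounded_bigcup t (fun z => bounded_mulr (bYz z)).
apply: bounded_sub => _ [y Yy [z Zz <-]].
have [x xt Hx] := tZ z Zz; exists x => //=.
exists (y * x); first by exists y.
by exists (x^-1 * z); rewrite // -mulgA mulVKg.
Qed.

Lemma bounded_inv Y : bounded Y -> bounded [set y^-1 | y in Y].
Proof.
move=> [s sY]; have := bounded_bigcup s (fun x => comm x^-1).
apply: bounded_sub => _ [y /sY[x xs Hx] <-]; exists x => //=.
exists (x^-1 * y)^-1; first exact: subgroupV.
by rewrite invgM invgK mulgK.
Qed.

(** Two elements of the kernel in the same left coset differ by an element of H
    in the kernel, which is 1. *)
Lemma bounded_kernel_finite (G : groupType) (f : E -> G) Y :
  {morph f : x y / x * y} -> (forall h, H h -> f h = 1 -> h = 1) ->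
  bounded Y -> finite_set (Y `&` [set y | f y = 1]).
Proof.
move=> fM fH [s sY].
pose r x := xget 1 [set y | H (x^-1 * y) /\ f y = 1].
apply: (@sub_finite_set _ _ (r @` [set` s])); last first.
  by apply: finite_image; exact: finite_seq.
move=> y [/sY[x xs Hx] /= fy]; exists x => //.
rewrite /r; case: xgetP => [z _ [Hz fz]|/(_ y)[]//].
apply: (@mulgI _ y^-1); rewrite mulVg; apply: fH.
  have := subgroupM sH (subgroupV sH Hx) Hz.
  by rewrite invgM invgK mulgA mulgK.
by rewrite fM (morphV fM) fy fz invg1 mulg1.
Qed.

End BoundedSets.

(** * From bounded presentations to graphs of groups *)
Definition partially_multiplicative (G Q : groupType) (C : set G) (f : G -> Q) :=
  forall x y, C x -> C y -> C (x * y) -> f (x * y) = f x * f y.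

(** The universal property of the group presented by the multiplication table of
    C. The homomorphism is asked to agree with f only on D, because f is not
    constrained elsewhere and C need not consist of short products of elements
    of D. *)
Definition boundedly_presented (G : topGroupType) : Prop :=
  exists U D C : set G,
    [/\ subgroup U, open U, compact U & U `<=` D] /\
    [/\ compact D, subgroup_generated D = [set: G], compact C &
    forall (Q : groupType) (f : G -> Q), partially_multiplicative C f ->
      exists2 g : G -> Q, {morph g : x y / x * y} & forall x, D x -> g x = f x].

(** The graph of groups with one vertex, whose group is U, and one loop for each
    s i, whose group embeds in U by inclusion and by conjugation by s i. *)
Section Bouquet.
Variables (G : topGroupType) (U : set G).
Hypotheses (hG : hausdorff_space G) (tdG : totally_disconnected [set: G]).
Hypotheses (sU : subgroup U) (oU : open U) (cU : compact U).
Variables (n : nat) (s : 'I_n -> G).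

Let K i := U `&` [set x | U (s i * x * (s i)^-1)].

Let sK i : subgroup (K i).
Proof. by apply: subgroupI => //; exact: subgroup_conj. Qed.

Let oK i : open (K i).
Proof. by apply: openI => //; exact: open_conj. Qed.

Let cK i : compact (K i).
Proof.
apply: subclosed_compact cU _; last by move=> x [].
apply: closedI; first exact: compact_closed.
apply: closed_comp (compact_closed hG cU) => x _; exact: conj_continuous.
Qed.

Let UT := subgroup_type sU.
Let KT i := subgroup_type (sK i).
Let valU : UT -> G := @subgroup_val _ _ sU.
Let valK i : KT i -> G := @subgroup_val _ _ (sK i).

Let src i (c : KT i) : UT := subgroup_elt sU (@subgroup_valP _ _ (sK i) c).2.
Let tgt i (c : KT i) : UT := subgroup_elt sU (@subgroup_valP _ _ (sK i) c).1.

Let srcM i : {morph @src i : x y / x * y}.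
Proof.
move=> x y; apply: (@subgroup_val_inj _ _ sU).
change (s i * (valK x * valK y) * (s i)^-1 =
  (s i * valK x * (s i)^-1) * (s i * valK y * (s i)^-1)).
by rewrite !mulgA mulgVK.
Qed.

Let tgtM i : {morph @tgt i : x y / x * y}.
Proof. by move=> x y; apply: (@subgroup_val_inj _ _ sU). Qed.

Let src_inj i : injective (@src i).
Proof.
move=> x y /(congr1 valU)/(@mulIg _ (s i)^-1)/(@mulgI _ (s i)).
exact: (@subgroup_val_inj _ _ (sK i)).
Qed.

Let tgt_inj i : injective (@tgt i).
Proof. by move=> x y /(congr1 valU); exact: (@subgroup_val_inj _ _ (sK i)). Qed.

Let src_cont i : continuous (@src i).
Proof.
apply: subgroup_type_continuous => x.
apply: (@continuous_comp _ _ _ (@valK i)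
  (fun y => s i * y * (s i)^-1)); first exact: subgroup_val_continuous.
exact: conj_continuous.
Qed.

Let tgt_cont i : continuous (@tgt i).
Proof. by apply: subgroup_type_continuous; exact: subgroup_val_continuous. Qed.

Let open_UT (W : set UT) : open (valU @` W) -> open W.
Proof.
move=> oW; rewrite (_ : W = valU @^-1` (valU @` W)).
  by apply: open_comp oW => x _; exact: subgroup_val_continuous.
apply/seteqP; split=> [x Wx|x [y Wy /subgroup_val_inj <-//]].
by exists x.
Qed.

Let tgt_open i : open_map (@tgt i).
Proof.
move=> W /(@open_subgroup_val _ _ (sK i) (oK i)) oW; apply: open_UT.
by rewrite image_comp; exact: oW.
Qed.

Let src_open i : open_map (@src i).
Proof.
move=> W /(@open_subgroup_val _ _ (sK i) (oK i)) oW; apply: open_UT.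
have := open_conj (s i)^-1 oW; congr open; apply/seteqP; split=> x /=.
  move=> [c Wc ec]; exists (src c); first by exists c.
  change (s i * valK c * (s i)^-1 = x); rewrite (ec : valK c = _).
  by rewrite !mulgA mulgV mul1g invgK mulgK.
move=> [_ [c Wc <-] <-]; exists c => //.
change (valK c = (s i)^-1 * (s i * valK c * (s i)^-1) * (s i)^-1^-1).
by rewrite !mulgA mulVg mul1g mulgK.
Qed.

Definition bouquet : profinite_graph :=
  @ProfiniteGraph unit 'I_n (fun _ => tt) (fun _ => tt) (fun _ => UT) KT
    src tgt (fun _ => subgroup_type_profinite sU hG tdG cU)
    (fun i => subgroup_type_profinite (sK i) hG tdG (cK (i := i)))
    srcM tgtM src_inj tgt_inj src_cont tgt_cont src_open tgt_open.

Let T0 : {set gedge bouquet} := finset.set0.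
Let E : groupType := pi1 T0.
Let u (a : UT) : E := @pi1_vgroup_map bouquet T0 tt a.
Let t i : E := @pi1_stable bouquet T0 i.

Let uM : {morph u : a b / a * b} := @pi1_vgroup_mapM bouquet T0 tt.

Let tK i (c : KT i) : t i * u (tgt c) = u (src c) * t i :=
  @pi1_stableE bouquet T0 i c.

Let H : set E := range u.

Let sH : subgroup H.
Proof.
split; first by exists 1; rewrite // (morph1 uM).
by move=> _ _ [a _ <-] [b _ <-]; exists (a / b); rewrite // uM (morphV uM).
Qed.

Let bouquet_ind (P : set E) :
  subgroup P -> (forall a, P (u a)) -> (forall i, P (t i)) -> forall x, P x.
Proof. by move=> sP Pu Pt; apply: pi1_ind => // -[]. Qed.

Let cosets (W : set G) : open W -> W 1 ->
  exists r : seq UT, forall a : UT, exists2 b, b \in r & W (valU (b^-1 * a)).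
Proof.
move=> oW W1; have [_ _ cT] := subgroup_type_profinite sU hG tdG cU.
have [|r _ cov] := @compact_cosets UT setT [set a : UT | W (valU a)] cT _ W1.
  by apply: open_comp oW => x _; exact: subgroup_val_continuous.
by exists r => a; apply: cov.
Qed.

(** The source embedding of the loop group is open, so finitely many cosets of its
    image cover U; and u (b * src c) t = u b t u (tgt c). *)
Let comm_t i : commensurates H (t i).
Proof.
have [|/=|r cov] := @cosets [set x | K i ((s i)^-1 * x * (s i)^-1^-1)].
- exact: open_conj.
- by rewrite mulg1 mulgV; exact: (sK i).1.
exists [seq u b * t i | b <- r] => _ [_ [a _ <-] <-].
have [b br Kb] := cov a; exists (u b * t i); first exact: map_f.
pose c : KT i := subgroup_elt (sK i) Kb.
have ab : a = b * src c.
  apply: (@subgroup_val_inj _ _ sU).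
  change (valU a = valU b *
    (s i * ((s i)^-1 * ((valU b)^-1 * valU a) * (s i)^-1^-1) * (s i)^-1)).
  by rewrite invgK !mulgA mulgK mulgK mulgV mul1g.
exists (tgt c) => //.
by rewrite ab uM invgM -!mulgA -tK !mulgA mulgVK mulVg mul1g.
Qed.

(** The same with the two ends of the loop exchanged. *)
Let comm_tV i : commensurates H (t i)^-1.
Proof.
have [|r cov] := @cosets (K i) (@oK i); first exact: (sK i).1.
exists [seq u b * (t i)^-1 | b <- r] => _ [_ [a _ <-] <-].
have [b br Kb] := cov a; exists (u b * (t i)^-1); first exact: map_f.
pose c : KT i := subgroup_elt (sK i) Kb.
have ab : a = b * tgt c.
  apply: (@subgroup_val_inj _ _ sU).
  change (valU a = valU b * ((valU b)^-1 * valU a)).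
  by rewrite mulVKg.
exists (src c) => //.
by rewrite ab uM invgM invgK -!mulgA mulKg !mulgA tK mulgK.
Qed.

Let comm x : commensurates H x.
Proof.
suff [] : commensurates H x /\ commensurates H x^-1 by [].
move: x; apply: bouquet_ind.
- exact: commensurator_subgroup.
- suff cu a : commensurates H (u a) by move=> a; rewrite -(morphV uM).
  exists [:: 1] => _ [h Hh <-]; exists 1; first by rewrite inE.
  by rewrite invg1 mul1g; apply: subgroupM => //; exists a.
- by move=> i; split; [exact: comm_t | exact: comm_tV].
Qed.

Let phi_ex : exists2 phi : E -> G, {morph phi : x y / x * y} &
  (forall a, phi (u a) = valU a) /\ (forall i, phi (t i) = s i).
Proof.
have [|i c|i|phi phiM [phiv phis]] :=
    @pi1_lift bouquet T0 G (fun _ => valU) s.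
- by [].
- by change (s i * valK c = s i * valK c * (s i)^-1 * s i); rewrite mulgVK.
- by rewrite inE.
by exists phi => //; split=> [a|i]; [exact: (phiv tt) | exact: phis].
Qed.

Variables (D C : set G).
Hypotheses (UD : U `<=` D) (sD : forall i, D (s i)).
Hypothesis (covD : forall x, D x -> exists i, U ((s i)^-1 * x)).
Hypotheses (genD : subgroup_generated D = [set: G]) (cC : compact C).
Hypothesis presD : forall (Q : groupType) (f : G -> Q),
  partially_multiplicative C f ->
  exists2 g : G -> Q, {morph g : x y / x * y} & forall x, D x -> g x = f x.

Lemma bouquet_presentation : compactly_presented G.
Proof.
have [phi phiM [phiu phit]] := phi_ex.
have phiH h : H h -> phi h = 1 -> h = 1.
  move=> [a _ <-]; rewrite phiu => a1; rewrite -(morph1 uM).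
  by congr u; apply: (@subgroup_val_inj _ _ sU).
have surj y : exists x, phi x = y.
  have : subgroup_generated D y by rewrite genD.
  apply: (@generated_min _ _ [set y | exists x, phi x = y]).
    split=> [|_ _ [a <-] [b <-]]; first by exists 1; exact: morph1.
    by exists (a / b); rewrite phiM (morphV phiM).
  move=> d /covD[i Ud]; exists (t i * u (subgroup_elt sU Ud)).
  by rewrite phiM phit phiu; exact: mulVKg.
have [sec secE] := choice surj.
have [c _ covC] := compact_cosets cC oU sU.1.
(* KK is covered by finitely many cosets, contains 1 and the generators, and
   maps onto a set that contains C. *)
pose s0 : seq E := 1 :: [seq sec y | y <- c] ++ [seq t i | i <- enum 'I_n].
pose KK : set E := [set x | exists2 y, y \in s0 & H (y^-1 * x)].
have bKK : bounded H KK by exists s0.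
have KKs y : y \in s0 -> KK y.
  by move=> ys; exists y => //; rewrite mulVg; exact: sH.1.
have KKu a : KK (u a).
  by exists 1; [exact: mem_head | rewrite invg1 mul1g; exists a].
have KKt i : KK (t i).
  by apply: KKs; rewrite inE mem_cat map_f ?orbT // mem_enum.
have KKC x : C x -> exists2 k, KK k & phi k = x.
  move=> /covC[y yc Uy]; exists (sec y * u (subgroup_elt sU Uy)).
    exists (sec y); first by rewrite inE mem_cat map_f ?orbT.
    by rewrite mulKg; exists (subgroup_elt sU Uy).
  by rewrite phiM secE phiu; exact: mulVKg.
pose F := [set x^-1 | x in KK].
have bF : bounded H [set x * y | x in F & y in [set y * z | y in KK & z in KK]].
  apply: bounded_mul => //; first exact: bounded_inv.
  exact: bounded_mul.
have /= finF := bounded_kernel_finite sH phiM phiH bF.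
set N := (X in finite_set X) in finF.
have [Q [q [qM kerq]]] := @quotient_by_normal_closure _ (pi1_relation T0) N.
(* Modulo the kernel elements of KK^-1 KK KK, products of elements of KK depend
   only on their images in G. *)
have q_eq a b c' : KK a -> KK b -> KK c' -> phi c' = phi a * phi b ->
    q c' = q a * q b.
  move=> Ka Kb Kc e; apply: (@mulgI _ (q c')^-1).
  rewrite mulVg -(morphV qM) -!qM; apply/esym/kerq.
  apply: subset_normal_closure; split.
    exists c'^-1; first by exists c'.
    by exists (a * b) => //; exists a => //; exists b.
  by rewrite /= !phiM (morphV phiM) e mulVg.
pose tau x := xget 1 [set k | KK k /\ phi k = x].
have tauP k : KK k -> KK (tau (phi k)) /\ phi (tau (phi k)) = phi k.
  by move=> Kk; rewrite /tau; case: xgetP => [y _ //|/(_ k)[]].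
pose f x := q (tau x).
have fphi k : KK k -> f (phi k) = q k.
  move=> Kk; have [Kt et] := tauP k Kk; rewrite /f.
  (* phi (tau (phi k)) = phi k * phi 1 puts this under q_eq, since 1 is in KK. *)
  rewrite (q_eq k 1 _ Kk _ Kt) ?(morph1 qM) ?mulg1 //.
    by apply: KKs; exact: mem_head.
  by rewrite (morph1 phiM) mulg1.
have [x y Cx Cy Cxy|g gM gf] := presD (f := f).
  have [c' Kc] := KKC _ Cxy.
  have [a Ka <-] := KKC x Cx; have [b Kb <-] := KKC y Cy => ec.
  by rewrite -ec !fphi //; exact: q_eq.
have gphi : forall x, g (phi x) = q x.
  apply: bouquet_ind.
  - split=> [|x y /= ex ey]; first by rewrite /= (morph1 phiM) (morph1 gM) (morph1 qM).
    by rewrite phiM gM qM (morphV phiM) (morphV gM) (morphV qM) ex ey.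
  - move=> a /=; rewrite gf ?fphi // phiu; apply: UD; exact: subgroup_valP.
  - by move=> i /=; rewrite gf ?fphi // phit.
have conn (T : {set gedge bouquet}) : edges_connected T.
  by split=> [|[] []]; [rewrite card_unit | exact: connect0].
exists bouquet, T0, phi, N; split; [|split; [|split; [|split; [|split; [|split; [|split; [|split]]]]]]].
- exact: conn.
- split; first exact: conn.
  by case=> [|y c' _ /= /andP[]]; rewrite ?inE.
- exact: phiM.
- apply/continuousP => W oW; rewrite pi1_openE => x [] /=.
  rewrite (_ : mkset _ = [set a : UT | W (phi x * valU a)]).
    apply: (open_comp _ (open_lmul (phi x) oW)) => a _.
    exact: subgroup_val_continuous.
  by apply/seteqP; split=> a /=; rewrite phiM phiu.
- (* Near phi x, the image contains the translate by phi x of an open part of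
     U, because x * u a stays in W for a near 1. *)
  move=> W oW; rewrite openE => _ [x Wx <-].
  have /(open_subgroup_val oU) oxW : open [set a : UT | W (x * u a)] := oW x tt.
  have : nbhs (phi x)
      [set y | (valU @` [set a : UT | W (x * u a)]) ((phi x)^-1 * y)].
    apply: open_nbhs_nbhs; split; first exact: open_lmul.
    by exists 1; rewrite /= ?(morph1 uM) ?mulg1 // mulVg.
  apply: filterS => y [a /= Wa ea]; exists (x * u a) => //.
  by rewrite phiM phiu (ea : valU a = _) mulVKg.
- by move=> y _; have [x] := surj y; exists x.
- by move=> [] a b; rewrite -!/(u _) !phiu; exact: subgroup_val_inj.
- by [].
apply/seteqP; split=> x.
  by move=> /= fx; apply/kerq; rewrite -gphi fx (morph1 gM).
by apply: normal_closure_min => [|{}x []//]; exact: kernel_normal_subgroup.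
Qed.

End Bouquet.

Theorem boundedly_presented_compactly (G : topGroupType) :
  tdlc G -> boundedly_presented G -> compactly_presented G.
Proof.
move=> [hG tdG _] [U [D [C [[sU oU cU UD] [cD genD cC presD]]]]].
have [r rD covD] := compact_cosets cD oU sU.1.
apply: (@bouquet_presentation G U hG tdG sU oU cU (size r)
  (fun i => nth 1 r i) D C) => //.
- by move=> i; apply: rD; exact: mem_nth.
- move=> x /covD[y]; rewrite -index_mem => yr Uy.
  by exists (Ordinal yr) => /=; rewrite nth_index // -index_mem.
Qed.

(** * From graphs of groups to bounded presentations *)
Lemma partially_multiplicativeS (G Q : groupType) (C C' : set G) (f : G -> Q) :
  C `<=` C' -> partially_multiplicative C' f -> partially_multiplicative C f.
Proof. by move=> CC' fM x y Cx Cy Cxy; apply: fM; exact: CC'. Qed.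

Lemma partially_multiplicative1 (G Q : groupType) (C : set G) (f : G -> Q) :
  partially_multiplicative C f -> C 1 -> f 1 = 1.
Proof.
move=> fM C1; apply: (@mulgI _ (f 1)); rewrite mulg1 -fM ?mulg1 //.
Qed.

(** Whether a homomorphism theta that agrees with f on generators also agrees
    with f at a given y can be decided by multiplying out a word for y, which
    uses the multiplicativity of f on a compact set only. That compact set
    depends on Y but not on f, on theta or on the target group. *)
Section LocallyDetermined.
Variables (E : groupType) (G : topGroupType) (phi : E -> G).
Hypothesis phiM : {morph phi : x y / x * y}.
Variable X : set E.
Implicit Types Y Z : set E.

Definition locally_determined Y := exists C : set G,
  [/\ compact C, phi @` Y `<=` C &
  forall (Q : groupType) (f : G -> Q) (theta : E -> Q),
    partially_multiplicative C f -> {morph theta : x y / x * y} ->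
    (forall x, X x -> theta x = f (phi x)) ->
    forall y, Y y -> theta y = f (phi y)].

Lemma locally_determined_self : compact (phi @` X) -> locally_determined X.
Proof. by move=> cX; exists (phi @` X); split. Qed.

Lemma locally_determinedS Y Z :
  Y `<=` Z -> locally_determined Z -> locally_determined Y.
Proof.
move=> YZ [C [cC ZC detC]]; exists C; split=> //.
  by move=> _ [y /YZ Zy <-]; apply: ZC; exists y.
by move=> Q f theta fM thM thX y /YZ; exact: (detC Q f theta).
Qed.

Lemma locally_determinedU Y Z :
  locally_determined Y -> locally_determined Z -> locally_determined (Y `|` Z).
Proof.
move=> [C [cC YC detC]] [C' [cC' ZC' detC']]; exists (C `|` C'); split.
- exact: compactU.
- move=> _ [y [Yy|Zy] <-]; [left; apply: YC | right; apply: ZC']; by exists y.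
- move=> Q f theta fM thM thX y [].
    apply: (detC Q f theta _ thM thX y).
    exact: (partially_multiplicativeS (@subsetUl _ C C') fM).
  apply: (detC' Q f theta _ thM thX y).
  exact: (partially_multiplicativeS (@subsetUr _ C C') fM).
Qed.

Lemma locally_determined_mul Y Z : locally_determined Y ->
  locally_determined Z -> locally_determined [set y * z | y in Y & z in Z].
Proof.
move=> [C [cC YC detC]] [C' [cC' ZC' detC']].
exists ((C `|` C') `|` [set x * y | x in C & y in C']); split.
- by apply: compactU; [exact: compactU | exact: compact_mulg].
- move=> _ [_ [y Yy [z Zz <-]] <-]; right; exists (phi y).
    by apply: YC; exists y.
  by exists (phi z); [apply: ZC'; exists z | rewrite phiM].
- move=> Q f theta fM thM thX _ [y Yy [z Zz <-]].
  have Cy : C (phi y) by apply: YC; exists y.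
  have Cz : C' (phi z) by apply: ZC'; exists z.
  rewrite phiM thM fM.
  + congr (_ * _); [apply: (detC Q f theta _ thM thX) => // |
      apply: (detC' Q f theta _ thM thX) => //].
      by apply: partially_multiplicativeS fM => x Cx; left; left.
    by apply: partially_multiplicativeS fM => x Cx; left; right.
  + by left; left.
  + by left; right.
  + by right; exists (phi y) => //; exists (phi z).
Qed.

Lemma locally_determined0 : locally_determined set0.
Proof. by exists set0; split; [exact: compact0 | move=> x [] |]. Qed.

Lemma locally_determined1 : locally_determined [set 1].
Proof.
exists [set 1]; split; first exact: compact_set1.
  by move=> _ [_ -> <-]; exact: morph1.
move=> Q f theta fM thM _ _ ->; rewrite (morph1 phiM) (morph1 thM).
by rewrite (partially_multiplicative1 fM).
Qed.

Lemma locally_determined_inv Y :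
  locally_determined Y -> locally_determined [set y^-1 | y in Y].
Proof.
move=> [C [cC YC detC]].
exists ((C `|` [set 1]) `|` [set x^-1 | x in C]); split.
- apply: compactU; first by apply: compactU => //; exact: compact_set1.
  apply: compact_image cC; exact: invg_continuous.
- move=> _ [_ [y Yy <-] <-]; right; exists (phi y); last by rewrite (morphV phiM).
  by apply: YC; exists y.
- move=> Q f theta fM thM thX _ [y Yy <-].
  have Cy : C (phi y) by apply: YC; exists y.
  apply: (@mulgI _ (theta y)); rewrite -thM mulgV (morph1 thM).
  rewrite (detC Q f theta _ thM thX y Yy); last first.
    by apply: partially_multiplicativeS fM => x Cx; left; left.
  rewrite (morphV phiM) -fM ?mulgV.
  + by apply/esym/(partially_multiplicative1 fM); left; right.
  + by left; left.
  + by right; exists (phi y).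
  + by left; right.
Qed.

Hypothesis genX : subgroup_generated X = [set: E].
Hypothesis cX : compact (phi @` X).

Lemma locally_determined_set1 x : locally_determined [set x].
Proof.
have : subgroup_generated X x by rewrite genX.
apply: (@generated_min _ _ [set x | locally_determined [set x]]) => [|{}x Xx].
  split; first exact: locally_determined1.
  move=> y z /= dy dz.
  have := locally_determined_mul dy (locally_determined_inv dz).
  apply: locally_determinedS => _ ->; exists y => //; exists z^-1 => //.
  by exists z.
by apply: locally_determinedS (locally_determined_self cX) => _ ->.
Qed.

Lemma locally_determined_bigcup (s : seq E) (Y : E -> set E) :
  (forall x, locally_determined (Y x)) ->
  locally_determined [set y | exists2 x, x \in s & Y x y].
Proof.
move=> dY; elim: s => [|x s IHs].
  by apply: locally_determinedS locally_determined0 => y [].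
apply: locally_determinedS (locally_determinedU (dY x) IHs) => y [z].
by rewrite inE => /orP[/eqP ->|zs] Yy; [left | right; exists z].
Qed.

Lemma locally_determined_finite F : finite_set F -> locally_determined F.
Proof.
move=> /finite_seqP[s ->].
apply: locally_determinedS (locally_determined_bigcup s locally_determined_set1).
by move=> x xs; exists x.
Qed.

End LocallyDetermined.

(** A compact set is covered by finitely many translates of U, and each of them
    is the product of a point and of a subset of D. *)
Lemma locally_determined_compact (G : topGroupType) (U D Y : set G) :
  subgroup U -> open U -> U `<=` D -> compact D ->
  subgroup_generated D = [set: G] -> compact Y -> locally_determined id D Y.
Proof.
move=> sU oU UD cD genD cY.
have [s _ covY] := compact_cosets cY oU sU.1.
have idM : {morph (id : G -> G) : x y / x * y} by [].
have cD' : compact (id @` D) by rewrite image_id.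
have dU x : locally_determined id D [set a * b | a in [set x] & b in U].
  apply: locally_determined_mul => //; first exact: locally_determined_set1.
  exact: locally_determinedS UD (locally_determined_self cD').
apply: locally_determinedS (locally_determined_bigcup s dU) => y /covY[x xs Ux].
by exists x => //=; exists x => //; exists (x^-1 * y) => //; rewrite mulVKg.
Qed.

(** The set on which the homomorphism agrees with f can be any compact set, at
    the cost of enlarging C. *)
Lemma boundedly_presented_on (G : topGroupType) : boundedly_presented G ->
  exists U D : set G,
    [/\ subgroup U, open U, compact U & U `<=` D] /\
    [/\ compact D, subgroup_generated D = [set: G] &
    forall Y, compact Y -> exists2 C, compact C &
    forall (Q : groupType) (f : G -> Q), partially_multiplicative C f ->
      exists2 g : G -> Q, {morph g : x y / x * y} & forall x, Y x -> g x = f x].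
Proof.
move=> [U [D [C [[sU oU cU UD] [cD genD cC presD]]]]].
exists U, D; do 2!split=> //; move=> Y cY.
have [C' [cC' _ detC']] := locally_determined_compact sU oU UD cD genD cY.
exists (C `|` C'); first exact: compactU.
move=> Q f fM; have [g gM gf] := presD Q f
  (partially_multiplicativeS (@subsetUl _ C C') fM).
exists g => // y Yy; apply: (detC' Q f g) => //.
exact: (partially_multiplicativeS (@subsetUr _ C C') fM).
Qed.

Theorem compactly_boundedly_presented (G : topGroupType) :
  compactly_presented G -> boundedly_presented G.
Proof.
move=> [L [T [phi [F [_ [tT [phiM [cphi [ophi [surj [_ [finF kerF]]]]]]]]]]]].
pose vmap v : vgroup v -> pi1 T := @pi1_vgroup_map L T v.
pose t (e : gedge L) : pi1 T := pi1_stable T e.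
pose X : set (pi1 T) := (\bigcup_(v in [set: gvert L]) range (vmap v)) `|` range t.
have Xv v a : X (vmap v a) by left; exists v => //; exists a.
have Xt e : X (t e) by right; exists e.
have genX : subgroup_generated X = [set: pi1 T].
  apply/seteqP; split=> // x _; move: x; apply: pi1_ind => [|v a|e].
  - exact: generated_subgroup.
  - by apply: subset_generated; exact: Xv.
  - by apply: subset_generated; exact: Xt.
have cU v : compact (phi @` range (vmap v)).
  apply: compact_image => //; apply: compact_image.
    exact: pi1_vgroup_map_continuous.
  by have [] := @vgroup_profinite L v.
have fin (I : finType) : finite_set [set: I] by exact: finite_finset.
have cX : compact (phi @` X).
  rewrite image_setU; apply: compactU.
    rewrite image_bigcup; apply: compact_bigcup => [|v _]; first exact: fin.
    exact: cU.
  by apply: finite_compact; do 2!apply: finite_image.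
have [C [cC _ detC]] := locally_determined_finite phiM genX cX finF.
have /card_gt0P[v0 _] := tT.1.1.
pose D := phi @` X.
have DX x : X x -> D (phi x) by exists x.
exists (phi @` range (vmap v0)), D,
  (C `|` ((D `|` [set 1]) `|` [set x * y | x in D & y in D])); split; split.
- split; first (exists 1; last exact: morph1).
    by exists 1 => //; exact: morph1 (@pi1_vgroup_mapM L T v0).
  move=> _ _ [_ [a _ <-] <-] [_ [b _ <-] <-].
  exists (vmap v0 (a / b)); first by exists (a / b).
  have vM := @pi1_vgroup_mapM L T v0.
  by rewrite /vmap vM (morphV vM) phiM (morphV phiM).
- by apply: ophi; apply: pi1_vgroup_open; exact: tT.1.
- exact: cU.
- by move=> _ [_ [a _ <-] <-]; exact: DX.
- exact: cX.
- apply/seteqP; split=> // y _; have [x _ <-] := surj y I.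
  have : subgroup_generated X x by rewrite genX.
  apply: (@generated_min _ _ [set x | subgroup_generated D (phi x)]).
    have sD := generated_subgroup D.
    split=> [|a b /= Da Db]; first by rewrite /= (morph1 phiM); exact: sD.1.
    by rewrite phiM (morphV phiM); apply: sD.2.
  by move=> z Xz; apply: subset_generated; exact: DX.
- apply: compactU => //; apply: compactU; last exact: compact_mulg.
  by apply: compactU => //; exact: compact_set1.
move=> Q f fM.
have fC : partially_multiplicative C f.
  by apply: partially_multiplicativeS fM => x Cx; left.
have f1 : f 1 = 1 by apply: partially_multiplicative1 fM _; right; left; right.
have fX x y : X x -> X y -> f (phi (x * y)) = f (phi x) * f (phi y).
  move=> Xx Xy; rewrite phiM fM //.
  - by right; left; left; exact: DX.
  - by right; left; left; exact: DX.
  - by right; right; exists (phi x); [exact: DX | exists (phi y); [exact: DX |]].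
have [v a b|e c|e eT|theta thM [thv thE]] :=
    @pi1_lift L T Q (fun v a => f (phi (vmap v a))) (fun e => f (phi (t e))).
- by rewrite -fX; [rewrite /vmap pi1_vgroup_mapM | exact: Xv | exact: Xv].
- rewrite -fX; [|exact: Xt | exact: Xv].
  by rewrite -fX; [rewrite /t /vmap pi1_stableE | exact: Xv | exact: Xt].
- by rewrite /t pi1_stable_tree // (morph1 phiM).
have thX x : X x -> theta x = f (phi x).
  by move=> [[v _ [a _ <-]]|[e _ <-]]; [exact: thv | exact: thE].
have thker x : phi x = 1 -> theta x = 1.
  move=> px; have : [set x | phi x = 1] x by [].
  rewrite kerF; apply: (normal_closure_min (kernel_normal_subgroup thM)) => y Fy /=.
  rewrite (detC Q f theta fC thM thX y Fy).
  have -> : phi y = 1; last by [].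
  have : [set x | phi x = 1] y; last by [].
  by rewrite kerF; exact: subset_normal_closure.
have /choice[sec secE] : forall y, exists x, phi x = y.
  by move=> y; have [x _ <-] := surj y I; exists x.
have gphi x : theta (sec (phi x)) = theta x.
  apply: divg1_eq; rewrite -(morphV thM) -thM; apply: thker.
  by rewrite phiM (morphV phiM) secE mulgV.
exists (theta \o sec) => [x y|_ [x Xx <-]] /=; last by rewrite gphi thX.
by rewrite -{1}[x]secE -{1}[y]secE -phiM gphi thM.
Qed.

(** * Commuting images and orbit representatives *)
Lemma commute_generated (K L Q : groupType) (f : K -> Q) (g : L -> Q)
    (X : set K) (Y : set L) :
  {morph f : x y / x * y} -> {morph g : x y / x * y} ->
  (forall x y, X x -> Y y -> commute (f x) (g y)) ->
  forall x y, subgroup_generated X x -> subgroup_generated Y y ->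
    commute (f x) (g y).
Proof.
move=> fM gM fg x y + Yy; apply: (@generated_min _ _ [set x | commute (f x) (g y)]).
  split=> [|a b /= fa fb].
    by apply/commute_sym; rewrite /= (morph1 fM); exact: commute1.
  rewrite fM (morphV fM); apply/commute_sym/commuteM; first exact: commute_sym.
  by apply: commuteV; exact: commute_sym.
move=> {}x Xx; move: y Yy; apply: generated_min; last by move=> y Yy; exact: fg.
split=> [|a b /= fa fb]; first by rewrite /= (morph1 gM); exact: commute1.
by rewrite gM (morphV gM); apply: commuteM => //; exact: commuteV.
Qed.

Lemma commute_conj (Q : groupType) (k x y : Q) :
  commute x y -> commute (k * x * k^-1) (k * y * k^-1).
Proof. by rewrite /commute => xy; rewrite !mulgA !mulgVK -!(mulgA k) xy. Qed.

Section OrbitRepresentatives.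
Variables (H : topGroupType) (V : choiceType) (adj : rel V) (act : H -> V -> V).
Hypothesis actV : graph_action adj act.

Lemma actK k v : act k^-1 (act k v) = v.
Proof. by have [a1 aM _] := actV; rewrite -aM mulVg. Qed.

Lemma actVK k v : act k (act k^-1 v) = v.
Proof. by have [a1 aM _] := actV; rewrite -aM mulgV. Qed.

Lemma orbit_act k v : range (act^~ (act k v)) = range (act^~ v).
Proof.
have [a1 aM _] := actV; apply/seteqP; split=> _ [h _ <-].
  by exists (h * k) => //=; rewrite aM.
by exists (h * k^-1) => //=; rewrite aM actK.
Qed.

(** Choosing in the orbit, as a set, rather than for each vertex, makes the
    representative constant on orbits. *)
Lemma vertex_representatives : finitely_many_orbits act [set: V] ->
  exists (r : V -> V) (hh : V -> H), [/\ finite_set (range r),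
    forall v, act (hh v) (r v) = v & forall k v, r (act k v) = r v].
Proof.
move=> fin; pose r v := xget v (range (act^~ v)).
have rP v : range (act^~ v) (r v).
  by apply: (@xgetPex _ v (range (act^~ v))); exists (act 1 v); exists 1.
have /choice[hh hhP] : forall v, exists h, act h (r v) = v.
  by move=> v; have [h _ <-] := rP v; exists h^-1; exact: actK.
exists r, hh; split=> //.
  (* As orbits are not empty, xget never returns its default; replacing that by
     a fixed v0 shows that r factors through the set of orbits. *)
  have [v0|noV] := pselect (exists v : V, True); last first.
    apply: (@sub_finite_set _ _ set0); last exact: finite_set0.
    by move=> x [v _ _]; case: noV; exists v.
  have {v0}[v0 _] := v0.
  apply: (@sub_finite_set _ _ (xget v0 @` [set range (act^~ x) | x in [set: V]])).
    move=> _ [v _ <-]; exists (range (act^~ v)); first by exists v.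
    rewrite /r /xget; case: pselect => // nv; case: nv.
    by exists (act 1 v); apply/asboolP; exists 1.
  exact: finite_image.
move=> k v; rewrite /r orbit_act /xget; case: pselect => // nv; case: nv.
by exists (act 1 v); apply/asboolP; exists 1.
Qed.

(** An edge is an unordered pair, so an element of H may carry the chosen pair
    to the given one with its ends exchanged; symmetry of adj absorbs this. *)
Lemma edge_representatives : simple_graph adj ->
  finitely_many_orbits (edge_action act) (edges adj) ->
  exists2 N : set V, finite_set N & forall v w, adj v w -> exists h v' w',
    [/\ N v', N w', adj v' w', act h v' = v & act h w' = w].
Proof.
move=> [symG irrG] fin.
have /choice[rep repP] : forall O : set (set V), exists E : set V,
    [set range ((edge_action act)^~ x) | x in edges adj] O ->
    edges adj E /\ range ((edge_action act)^~ E) = O.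
  move=> O; have [[E EE <-]|nO] :=
    pselect ([set range ((edge_action act)^~ x) | x in edges adj] O).
    by exists E.
  by exists set0.
pose R := rep @` [set range ((edge_action act)^~ x) | x in edges adj].
exists (\bigcup_(E in R) E).
  apply: bigcup_finite; first exact: finite_image.
  move=> _ [W EW <-]; have [[v [w [_ ->]]] _] := repP W EW.
  by rewrite finite_setU; split; exact: finite_set1.
move=> v w vw; set E := [set v; w].
have EE : edges adj E by exists v, w.
have EO : [set range ((edge_action act)^~ x) | x in edges adj]
  (range ((edge_action act)^~ E)) by exists E.
have [[v' [w' [vw' e']]] eO] := repP _ EO.
have : range ((edge_action act)^~ E) E.
  exists 1 => //; rewrite /edge_action; have [a1 _ _] := actV.
  by apply/seteqP; split=> [_ [x Ex <-]|x Ex]; [rewrite a1 | exists x].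
rewrite -eO => -[h _]; rewrite e' /edge_action => eE.
have Nx x : [set v'; w'] x -> (\bigcup_(E in R) E) x.
  move=> x'; exists [set v'; w'] => //; rewrite -e'.
  by exists (range ((edge_action act)^~ E)).
have Nv' : (\bigcup_(E in R) E) v' by apply: Nx; left.
have Nw' : (\bigcup_(E in R) E) w' by apply: Nx; right.
have [x xE hx] : (act h @` [set v'; w']) v by rewrite eE; left.
have [y yE hy] : (act h @` [set v'; w']) w by rewrite eE; right.
case: xE yE hx hy => -> [] -> hv hw.
- by move: vw; rewrite -hv -hw irrG.
- by exists h, v', w'.
- by exists h, w', v'; split=> //; rewrite symG.
- by move: vw; rewrite -hv -hw irrG.
Qed.

End OrbitRepresentatives.

(** * Extending partial homomorphisms to a graph-wreath product *)
Section WreathAlgebra.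
Variables (B H G : topGroupType) (A : set B) (V : choiceType) (adj : rel V).
Variables (act : H -> V -> V) (iota : polyhedral_product A adj -> G) (j : H -> G).
Hypotheses (actV : graph_action adj act) (subA : subgroup A).
Hypotheses (iotaM : {morph iota : x y / x * y}) (jM : {morph j : x y / x * y}).

Let cp v b : G := iota (pp_copy A adj v b).
Let bs (a : V -> A) : G := iota (pp_base adj a).

Hypothesis j_cp : forall h v b, j h * cp v b * (j h)^-1 = cp (act h v) b.
Hypothesis j_bs : forall h a,
  j h * bs a * (j h)^-1 = bs (fun v => a (act h^-1 v)).
Hypothesis iota_j :
  bijective (fun x : polyhedral_product A adj * H => iota x.1 * j x.2).

Lemma copyM v : {morph cp v : b c / b * c}.
Proof.
move=> b c; have /pres_word_rel := @pp_copy_mul B A V adj v b c.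
by rewrite -[[:: _; _]]cat1s pres_word_cat /cp -iotaM => /(congr1 iota).
Qed.

Lemma baseM (a b c : V -> A) :
  (forall v, \val (c v) = \val (a v) * \val (b v)) -> bs a * bs b = bs c.
Proof.
move=> abc; have /pres_word_rel := @pp_base_mul B A V adj a b c abc.
by rewrite -[[:: _; _]]cat1s pres_word_cat /bs -iotaM => /(congr1 iota).
Qed.

Lemma base_copy (a : V -> A) w :
  (forall v, v != w -> \val (a v) = 1) -> bs a = cp w (\val (a w)).
Proof.
by move=> aw; have /pres_word_rel/(congr1 iota) := @pp_base_copy B A V adj a w aw.
Qed.

Lemma copy_base_commute (a : V -> A) w b :
  \val (a w) = 1 -> commute (cp w b) (bs a).
Proof.
move=> aw; have /pres_word_rel := @pp_base_comm B A V adj a w b aw.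
rewrite -[[:: _; _]]cat1s -[[:: _; _]]cat1s !pres_word_cat.
by move=> /(congr1 iota); rewrite !iotaM.
Qed.

Lemma copy_adj_commute v w b c : adj v w -> commute (cp v b) (cp w c).
Proof.
move=> vw; have /pres_word_rel := @pp_adj_comm B A V adj v w b c vw.
rewrite -[[:: _; _]]cat1s -[[:: _; _]]cat1s !pres_word_cat.
by move=> /(congr1 iota); rewrite !iotaM.
Qed.

Variables (r : V -> V) (hh : V -> H).
Hypothesis hhP : forall v, act (hh v) (r v) = v.
Hypothesis r_act : forall k v, r (act k v) = r v.
Variables (DH : set H) (DB : set B).
Hypothesis genH : subgroup_generated DH = [set: H].
Hypothesis genB : subgroup_generated DB = [set: B].

Lemma wreath_generated (K : set G) : subgroup K ->
  (forall h, DH h -> K (j h)) -> (forall a, K (bs a)) ->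
  (forall v b, DB b -> K (cp (r v) b)) -> forall x, K x.
Proof.
move=> sK KH KA KB.
have Kj h : K (j h).
  have : subgroup_generated DH h by rewrite genH.
  apply: (@generated_min _ _ [set h | K (j h)]) => //.
  split=> [|a b /= Ka Kb]; first by rewrite /= (morph1 jM); exact: sK.1.
  by rewrite jM (morphV jM); exact: sK.2.
have Kr v b : K (cp (r v) b).
  have : subgroup_generated DB b by rewrite genB.
  apply: (@generated_min _ _ [set b | K (cp (r v) b)]) => [|c]; last exact: KB.
  split=> [|a c /= Ka Kc]; first by rewrite /= (morph1 (copyM (r v))); exact: sK.1.
  by rewrite copyM (morphV (copyM (r v))); exact: sK.2.
have Kc v b : K (cp v b).
  rewrite -[v]hhP -j_cp; apply: subgroupM => //; last exact: subgroupV.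
  exact: subgroupM.
have Ki p : K (iota p).
  move: p; apply: (@presented_group_ind _ _ [set p | K (iota p)]).
    split=> [|a b /= Ka Kb]; first by rewrite /= (morph1 iotaM); exact: sK.1.
    by rewrite iotaM (morphV iotaM); exact: sK.2.
  by case=> [a|[v b]]; [exact: KA | exact: Kc].
move=> x; have [dec _ decK] := iota_j; rewrite -[x]decK.
exact: subgroupM.
Qed.

Section Extension.
Variables (M : set V) (YH : set H) (YB : set B).
Hypotheses (Mr : forall v, M (r v)) (MYH : forall v, M v -> YH (hh v)).
Hypotheses (DYH : DH `<=` YH) (DYB : DB `<=` YB) (AYB : A `<=` YB).
Variable (X : V -> set H).
Hypothesis stabX : forall v, subgroup_generated (X v) = stabiliser act v.
Hypothesis XYH : forall v, X (r v) `<=` YH.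
Hypothesis edgeM : forall v w, adj v w -> exists h v' w',
    [/\ M v', M w', adj v' w', act h v' = v & act h w' = w].

(** Besides a compact part of H, the base, and compact parts of the copies at
    the representatives r v, this contains parts of the copies at the ends of
    finitely many edges, through which commutation along edges is read off. *)
Definition wreath_generators : set G :=
  (j @` YH `|` range bs) `|` [set x | exists2 v, M v & (cp v @` YB) x].
Local Notation C1 := wreath_generators.

Variables (Q : groupType) (f : G -> Q).
Hypothesis fC1 : partially_multiplicative
  (C1 `|` [set x * y | x in C1 & y in C1]) f.
Variable gH : H -> Q.
Hypotheses (gHM : {morph gH : x y / x * y}).
Hypothesis gHf : forall h, YH h -> gH h = f (j h).
Variable gB : V -> B -> Q.
Hypothesis gBM : forall v, {morph gB (r v) : x y / x * y}.
Hypothesis gBf : forall v b, YB b -> gB (r v) b = f (cp (r v) b).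

Let C1j h : YH h -> C1 (j h).
Proof. by move=> Yh; left; left; exists h. Qed.
Let C1bs a : C1 (bs a).
Proof. by left; right; exists a. Qed.
Let C1cp v b : M v -> YB b -> C1 (cp v b).
Proof. by move=> Mv Yb; right; exists v => //; exists b. Qed.

Let fM x y : C1 x -> C1 y -> f (x * y) = f x * f y.
Proof.
move=> Cx Cy; apply: fC1; [by left | by left | right].
by exists x => //; exists y.
Qed.

(** The commutation and conjugation relations all have this shape, which is why
    products of two generators are enough. *)
Let f_square x y z w : C1 x -> C1 y -> C1 z -> C1 w ->
  x * y = z * w -> f x * f y = f z * f w.
Proof. by move=> Cx Cy Cz Cw e; rewrite -!fM ?e. Qed.

Let j_cp' h v b : j h * cp v b = cp (act h v) b * j h.
Proof. by rewrite -j_cp mulgVK. Qed.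

Let j_bs' h a : j h * bs a = bs (fun v => a (act h^-1 v)) * j h.
Proof. by rewrite -j_bs mulgVK. Qed.

(** The value forced on the copy at v by equivariance under H. *)
Let gv v b := gH (hh v) * gB (r v) b * (gH (hh v))^-1.

Let gvM v : {morph gv v : b c / b * c}.
Proof. by move=> b c; rewrite /gv gBM !mulgA mulgVK. Qed.

Let stab_commute v k b :
  stabiliser act (r v) k -> commute (gH k) (gB (r v) b).
Proof.
rewrite -stabX => Xk.
apply: (@commute_generated _ _ _ gH (gB (r v)) (X (r v)) DB) => //; last first.
  by rewrite genB.
move=> {Xk}k {}b Xk Db; rewrite gHf; last exact: XYH Xk.
rewrite gBf; last exact: DYB.
apply: f_square.
- by apply/C1j/(XYH Xk).
- by apply: C1cp => //; exact: DYB.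
- by apply: C1cp => //; exact: DYB.
- by apply/C1j/(XYH Xk).
- have : stabiliser act (r v) k by rewrite -stabX; exact: subset_generated.
  by rewrite j_cp' => ->.
Qed.

(** The two elements of H that carry r v to k v, namely hh (k v) and k (hh v),
    differ by an element of the stabiliser of r v. *)
Let gv_act k v b : gv (act k v) b = gH k * gv v b * (gH k)^-1.
Proof.
have [a1 aM _] := actV.
rewrite /gv r_act; set h := hh (act k v).
have st : stabiliser act (r v) (h^-1 * (k * hh v)).
  rewrite /stabiliser /= !aM hhP -[in RHS](r_act k v) -(actK actV h (r _)).
  by congr act; rewrite hhP.
have := stab_commute b st; rewrite /commute !gHM (morphV gHM).
move=> /(congr1 (fun z => gH h * z * (gH (hh v))^-1 * (gH k)^-1)).
by rewrite !mulgA mulgV mul1g => ->; rewrite !mulgK.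
Qed.

Let gv_f v b : M v -> YB b -> gv v b = f (cp v b).
Proof.
move=> Mv Yb; rewrite /gv gHf ?gBf //; last exact: MYH.
rewrite (@f_square _ _ (cp v b) (j (hh v))) ?mulgK //.
- by apply/C1j/MYH.
- exact: C1cp.
- exact: C1cp.
- by apply/C1j/MYH.
- by rewrite j_cp' hhP.
Qed.

(** Written as a relation between a and its translate a', equivariance passes
    from x and y to x / y, so that only generators k are left to treat. *)
Let bs_equivariant k (a a' : V -> A) : (forall v, a' v = a (act k^-1 v)) ->
  f (bs a') = gH k * f (bs a) * (gH k)^-1.
Proof.
have [a1 aM _] := actV.
have : subgroup_generated DH k by rewrite genH.
pose S := [set k | forall a a' : V -> A, (forall v, a' (act k v) = a v) ->
  gH k * f (bs a) = f (bs a') * gH k].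
move=> Dk ka; have : S k.
  move: k Dk {a a' ka}; apply: generated_min.
    split=> [a a' ka|x y /= Sx Sy a a' ka].
      rewrite (morph1 gHM) mul1g mulg1; congr (f (bs _)).
      by apply/funext => v; rewrite -ka a1.
    pose c v := a (act y v).
    rewrite gHM (morphV gHM); apply: (@mulIg _ (gH y)).
    rewrite -!mulgA mulVg mulg1 -(Sx c).
      congr (_ * _); apply: (@mulgI _ (gH y)); rewrite mulVKg.
      by apply/esym/Sy => v.
    move=> v; rewrite /c -ka aM.
    by rewrite (actK actV).
  move=> k Dk a a' ka.
  have -> : a' = fun v => a (act k^-1 v).
    by apply/funext => v; rewrite -ka (actVK actV).
  rewrite gHf; last exact: DYH.
  by apply: f_square => //; apply/C1j/DYH.
move=> /(_ a a') ->; first by rewrite mulgK.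
by move=> v; rewrite ka (actK actV).
Qed.

(** By generation of B when w is a representative, and by conjugation with hh w
    in general. *)
Let gv_bs_commute (a : V -> A) w b :
  \val (a w) = 1 -> commute (gv w b) (f (bs a)).
Proof.
have rep v c (a' : V -> A) :
    \val (a' (r v)) = 1 -> commute (gv (r v) c) (f (bs a')).
  move=> a'v; have : subgroup_generated DB c by rewrite genB.
  apply: (@generated_min _ _ [set c | commute (gv (r v) c) (f (bs a'))]).
    split=> [|x y /= cx cy].
      by apply/commute_sym; rewrite /= (morph1 (gvM (r v))); exact: commute1.
    rewrite gvM (morphV (gvM (r v))); apply/commute_sym/commuteM.
      exact: commute_sym.
    by apply: commuteV; exact: commute_sym.
  move=> x /DYB Yx /=; rewrite gv_f //.
  apply: f_square => //; try exact: C1cp.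
  exact: copy_base_commute.
move=> aw; rewrite -[w]hhP gv_act.
rewrite (@bs_equivariant (hh w) (fun v => a (act (hh w) v)) a).
  by apply/commute_conj/rep; rewrite hhP.
by move=> v; rewrite (actVK actV).
Qed.

(** The relations between different factors are conjugated to the chosen
    representatives of vertices or edges, where they follow from equalities
    between products of elements of C1. *)
Let cp_relation_lift : exists2 gP : polyhedral_product A adj -> Q,
  {morph gP : x y / x * y} &
  (forall a, gP (pp_base adj a) = f (bs a)) /\
  (forall v b, gP (pp_copy A adj v b) = gv v b).
Proof.
have [a1 aM _] := actV.
pose h (s : pp_generators A V) : Q :=
  match s with inl a => f (bs a) | inr vb => gv vb.1 vb.2 end.
have [|gP gPM gPh] := @presented_group_lift _ (@pp_relation B A V adj) Q h; last first.
  exists gP => //; split=> [a|v b]; first exact: (gPh (inl a)).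
  exact: (gPh (inr (v, b))).
move=> _ _ [a b c abc|v b c|a w aw|a w b aw|v w b c vw];
  rewrite /word_value !big_cons big_nil !mulg1 /=.
- by rewrite -fM // (baseM abc).
- by rewrite gvM.
- pose a' v := a (act (hh w) v).
  rewrite (@bs_equivariant (hh w) a' a); last by move=> v; rewrite /a' (actVK actV).
  have a'w : forall v, v != r w -> \val (a' v) = 1.
    move=> v vw; apply: aw; apply: contra_neq vw => e.
    by rewrite -[v](actK actV (hh w)) e -[in RHS](actK actV (hh w) (r w)) hhP.
  rewrite (base_copy a'w) -gv_f //; last by apply: AYB; exact: set_valP.
  by rewrite -gv_act /a' hhP.
- exact: gv_bs_commute.
- have [k [v' [w' [Mv Mw vw' <- <-]]]] := edgeM vw.
  rewrite !gv_act; apply: commute_conj.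
  apply: (@commute_generated _ _ _ (gv v') (gv w') DB DB); rewrite ?genB //.
  move=> {}b {}c /DYB Yb /DYB Yc; rewrite !gv_f //.
  apply: f_square; try exact: C1cp.
  exact: copy_adj_commute.
Qed.

(** Every element of G is uniquely iota p * j k, and the homomorphisms on the
    two factors fit together because gP is equivariant; equivariance is checked
    on the generators of the polyhedral product. *)
Lemma wreath_extension : exists2 g : G -> Q, {morph g : x y / x * y} &
  forall x, (C1 `|` [set x * y | x in C1 & y in C1]) x -> g x = f x.
Proof.
have [gP gPM [gPb gPc]] := cp_relation_lift.
have [dec decK Kdec] := iota_j.
have equiv p : forall k, exists2 p', j k * iota p = iota p' * j k
    & gH k * gP p = gP p' * gH k.
  move: p; apply: presented_group_ind.
  - split=> [k|p q /= ep eq k].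
      by exists 1; rewrite ?(morph1 iotaM) ?(morph1 gPM) mulg1 mul1g.
    have [p' jp gp] := ep k; have [q' jq gq] := eq k.
    exists (p' / q'); rewrite ?iotaM ?gPM ?(morphV iotaM) ?(morphV gPM).
      rewrite mulgA jp; apply: (@mulIg _ (iota q)).
      by rewrite mulgVK -!mulgA jq mulKg.
    rewrite mulgA gp; apply: (@mulIg _ (gP q)).
    by rewrite mulgVK -!mulgA gq mulKg.
  - case=> [a|[v b]] k.
      exists (pp_base adj (fun v => a (act k^-1 v))); first exact: j_bs'.
      rewrite !gPb (@bs_equivariant k a _ (fun _ => erefl _)).
      by rewrite mulgVK.
    exists (pp_copy A adj (act k v) b); first exact: j_cp'.
    by rewrite !gPc gv_act mulgVK.
pose g x := gP (dec x).1 * gH (dec x).2.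
have gE p k : g (iota p * j k) = gP p * gH k by rewrite /g (decK (p, k)).
have gM : {morph g : x y / x * y}.
  move=> x y; rewrite -[x]Kdec -[y]Kdec.
  case: (dec x) => p k; case: (dec y) => q l /=.
  have [q' jq gq] := equiv q k.
  have -> : iota p * j k * (iota q * j l) = iota (p * q') * j (k * l).
    by rewrite iotaM jM !mulgA -(mulgA (iota p) (j k) (iota q)) jq !mulgA.
  by rewrite !gE gPM gHM !mulgA -(mulgA (gP p) (gH k) (gP q)) gq !mulgA.
have gj h : g (j h) = gH h.
  by rewrite -[j h]mul1g -(morph1 iotaM) gE (morph1 gPM) mul1g.
have gi p : g (iota p) = gP p.
  by rewrite -[iota p]mulg1 -(morph1 jM) gE (morph1 gHM) mulg1.
have gC1 x : C1 x -> g x = f x.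
  move=> [[[h Yh <-]|[a _ <-]]|[v Mv [b Yb <-]]].
  - by rewrite gj gHf.
  - by rewrite gi gPb.
  - by rewrite gi gPc gv_f.
exists g => // z [/gC1 //|[x Cx [y Cy <-]]].
by rewrite gM fM // !gC1.
Qed.

End Extension.
End WreathAlgebra.

(** * Compact open subgroups of a graph-wreath product *)
Lemma open_setX (X Y : topologicalType) (P : set X) (Q : set Y) :
  open P -> open Q -> open (P `*` Q).
Proof.
move=> oP oQ; rewrite (_ : P `*` Q = fst @^-1` P `&` snd @^-1` Q) //.
by apply: openI; [apply: open_comp oP | apply: open_comp oQ] => x _;
  [exact: cvg_fst | exact: cvg_snd].
Qed.

Section WreathTopology.
Variables (B H G P : topGroupType) (A : set B) (V : choiceType) (adj : rel V).
Variables (act : H -> V -> V) (e : polyhedral_product A adj -> P).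
Variables (i : P -> G) (j : H -> G).
Hypotheses (subA : subgroup A) (compactA : compact A) (openA : open A).
Hypotheses (eM : {morph e : x y / x * y}) (iM : {morph i : x y / x * y}).
Hypothesis jM : {morph j : x y / x * y}.
Hypothesis base_cont : continuous (e \o pp_base adj : {ptws V -> A} -> P).
Hypothesis base_open : open_map (e \o pp_base adj : {ptws V -> A} -> P).
Hypothesis ij_cont : continuous (fun x : P * H => i x.1 * j x.2).
Hypothesis ij_open : open_map (fun x : P * H => i x.1 * j x.2).
Hypothesis j_bs : forall h (a : V -> A),
  j h * i (e (pp_base adj a)) * (j h)^-1 =
  i (e (pp_base adj (fun v => a (act h^-1 v)))).

Let iota := i \o e.
Let iotaM : {morph iota : x y / x * y} := morph_comp eM iM.
Let cp v b : G := iota (pp_copy A adj v b).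
Let bs (a : V -> A) : G := iota (pp_base adj a).

Lemma wreath_j_continuous : continuous j.
Proof.
rewrite (_ : j = (fun x : P * H => i x.1 * j x.2) \o pair 1).
  move=> h; apply: continuous_comp; last exact: ij_cont.
  by apply: cvg_pair; [exact: cvg_cst | exact: cvg_id].
by apply/funext => h /=; rewrite (morph1 iM) mul1g.
Qed.

Lemma wreath_i_continuous : continuous i.
Proof.
rewrite (_ : i = (fun x : P * H => i x.1 * j x.2) \o (fun p => (p, 1))).
  move=> h; apply: continuous_comp; last exact: ij_cont.
  by apply: cvg_pair; [exact: cvg_id | exact: cvg_cst].
by apply/funext => h /=; rewrite (morph1 jM) mulg1.
Qed.

Lemma wreath_base_continuous : continuous (bs : {ptws V -> A} -> G).
Proof.
move=> a; apply: (@continuous_comp _ _ _ (e \o pp_base adj : {ptws V -> A} -> P) i).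
  exact: base_cont.
exact: wreath_i_continuous.
Qed.

Lemma compact_wreath_base : compact (range bs).
Proof.
apply: (@compact_image {ptws V -> A} G bs); first exact: wreath_base_continuous.
have := @tychonoff V (fun _ => A) (fun _ => setT)
  (fun _ => compact_set_type compactA).
by congr compact; apply/seteqP; split.
Qed.

(** On the open subgroup A, the copy at v is the composite of the inclusion of A
    as the factor v of A^V with the continuous map from A^V. *)
Lemma wreath_copy_continuous v : continuous (cp v).
Proof.
have cpM : {morph cp v : b c / b * c} := copyM iotaM v.
apply: morph_continuous1 => // W W1.
pose one : A := exist _ 1 (mem_set subA.1).
pose k (a : A) : G := bs (dfwith (fun _ => one) v a).
have kE (a : A) : k a = cp v (set_val a).
  rewrite [LHS](@base_copy _ _ _ _ _ iota _ v); first by rewrite dfwithin.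
  by move=> w wv; rewrite dfwithout // eq_sym.
have ck : continuous k.
  move=> a; apply: (@continuous_comp A {ptws V -> A} G
    (dfwith (fun _ => one) v) bs); last exact: wreath_base_continuous.
  exact: (@dfwith_continuous V (fun _ => A) (fun _ => one) v a).
have k1 : k one = 1 by rewrite kE (morph1 cpM).
have : nbhs one (k @^-1` W) by apply: ck; rewrite k1.
move=> [_ [[W' oW' <-] W'1 sW']].
rewrite nbhsE; exists (W' `&` A).
  by split; [exact: openI | split=> //; exact: subA.1].
move=> b [W'b Ab]; have := sW' (exist _ b (mem_set Ab)).
by rewrite /= kE; apply.
Qed.

Lemma wreath_base_subgroup : subgroup (range bs).
Proof.
pose one : A := exist _ 1 (mem_set subA.1).
split.
  exists (fun _ => one) => //; apply: (@mulgI _ (bs (fun _ => one))).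
  by rewrite mulg1; apply: (baseM iotaM) => v /=; rewrite mulg1.
move=> _ _ [a _ <-] [b _ <-].
pose c v : A := exist (fun x => x \in A) (\val (a v) / \val (b v))
  (mem_set (subA.2 _ _ (set_valP (a v)) (set_valP (b v)))).
exists c => //; apply: (@mulIg _ (bs b)).
rewrite mulgVK; apply: (baseM iotaM) => v.
by rewrite mulgVK.
Qed.

Variable (W : set H).
Hypotheses (subW : subgroup W) (openW : open W) (compactW : compact W).

Definition wreath_compact_open : set G :=
  [set x * y | x in range bs & y in j @` W].

Lemma compact_wreath_compact_open : compact wreath_compact_open.
Proof.
apply: compact_mulg; first exact: compact_wreath_base.
by apply: compact_image => //; exact: wreath_j_continuous.
Qed.

(** It is the image, under the open map from P * H to G, of the product of the
    open image of A^V in P and of W. *)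
Lemma open_wreath_compact_open : open wreath_compact_open.
Proof.
have oR : open (range (e \o pp_base adj : {ptws V -> A} -> P)).
  by apply: base_open; exact: openT.
have := ij_open (open_setX oR openW); congr open; apply/seteqP; split.
  move=> _ [[p w] /= [[a _ <-] Ww] <-]; exists (bs a); first by exists a.
  by exists (j w); first by exists w.
move=> _ [_ [a _ <-] [_ [w Ww <-] <-]].
by exists (e (pp_base adj a), w) => //; split=> //; exists a.
Qed.

(** W normalises the image of A^V. *)
Lemma subgroup_wreath_compact_open : subgroup wreath_compact_open.
Proof.
have [b1 bF] := wreath_base_subgroup.
split.
  exists 1 => //; exists 1; last by rewrite mulg1.
  by exists 1; [exact: subW.1 | exact: morph1].
move=> _ _ [x bx [_ [k Wk <-] <-]] [y yb [_ [l Wl <-] <-]].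
have Wkl : W (k / l) by exact: subW.2.
have by' : range bs (j (k / l) * y * (j (k / l))^-1).
  case: yb => b _ <-; rewrite j_bs.
  by exists (fun v => b (act (k / l)^-1 v)).
exists (x / (j (k / l) * y * (j (k / l))^-1)); first exact: bF.
exists (j (k / l)); first by exists (k / l).
rewrite (_ : x * j k / (y * j l) = x * j (k / l) / y).
  by rewrite !invgM invgK !mulgA mulgVK.
by rewrite jM (morphV jM) invgM !mulgA.
Qed.

End WreathTopology.

(** * The graph-wreath product *)
Lemma bijective_change_left (X P Y : Type) (G : groupType) (e : X -> P)
    (i : P -> G) (j : Y -> G) :
  bijective e -> bijective (fun x : P * Y => i x.1 * j x.2) ->
  bijective (fun x : X * Y => (i \o e) x.1 * j x.2).
Proof.
move=> [ei eK Ke] bij_ij.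
have bij_e : bijective (fun x : X * Y => (e x.1, x.2)).
  by exists (fun x => (ei x.1, x.2)) => -[x y] /=; rewrite ?eK ?Ke.
exact: (bij_comp bij_ij bij_e).
Qed.

Section GraphWreathProduct.
Variables (B H G : topGroupType) (A : set B) (V : choiceType) (adj : rel V).
Variable act : H -> V -> V.
Hypotheses (subA : subgroup A) (compactA : compact A) (openA : open A).
Hypotheses (graphV : simple_graph adj) (actV : graph_action adj act).
Hypothesis GW : is_graph_wreath_product A adj act G.
Hypothesis finV : finitely_many_orbits act [set: V].

Lemma wreath_compactly_generated :
  compactly_generated [set: B] -> compactly_generated [set: H] ->
  compactly_generated [set: G].
Proof.
move=> [DB cDB genB] [DH cDH genH].
have [P [e [i [j [[[_ eM bij_e] [_ bc bo]] [_ [iM [jM]]]]]]]] := GW.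
move=> [jcp [jbs [bij_f [fc fo]]]].
have [r [hh [finr hhP r_act]]] := vertex_representatives actV finV.
have iotaM := morph_comp eM iM.
pose cp v b := i (e (pp_copy A adj v b)).
pose bs a := i (e (pp_base adj a)).
have bij := bijective_change_left bij_e bij_f.
have cj := wreath_j_continuous iM fc.
have ccp := wreath_copy_continuous subA openA eM iM jM bc fc.
have cbs := compact_wreath_base compactA jM bc fc.
pose D : set G := (j @` DH `|` range bs) `|` \bigcup_(v in range r) (cp v @` DB).
exists D.
  apply: compactU.
    by apply: compactU; [exact: compact_image | exact: cbs].
  apply: compact_bigcup => // v _; apply: compact_image => //; exact: ccp.
apply/seteqP; split=> // x _.
apply: (wreath_generated iotaM jM jcp bij hhP genH genB).
- exact: generated_subgroup.
- by move=> h Dh; apply: subset_generated; left; left; exists h.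
- by move=> a; apply: subset_generated; left; right; exists a.
- move=> v b Db; apply: subset_generated; right; exists (r v); first by exists v.
  by exists b.
Qed.

Lemma wreath_boundedly_presented :
  boundedly_presented B -> boundedly_presented H ->
  (forall v, compactly_generated (stabiliser act v)) ->
  finitely_many_orbits (edge_action act) (edges adj) ->
  boundedly_presented G.
Proof.
move=> /boundedly_presented_on[UB [DB [_ [cDB genB presB]]]].
move=> /boundedly_presented_on[W [DH [[sW oW cW WD] [cDH genH presH]]]] stab finE.
have [P [e [i [j [[[_ eM bij_e] [_ bc bo]] [_ [iM [jM]]]]]]]] := GW.
move=> [jcp [jbs [bij_f [fc fo]]]].
have [r [hh [finr hhP r_act]]] := vertex_representatives actV finV.
have [N finN edgeN] := edge_representatives actV graphV finE.
have iotaM := morph_comp eM iM.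
have bij := bijective_change_left bij_e bij_f.
have cj := wreath_j_continuous iM fc.
pose cp v b := i (e (pp_copy A adj v b)).
have ccp : forall v, continuous (cp v) :=
  wreath_copy_continuous subA openA eM iM jM bc fc.
have cbs := compact_wreath_base compactA jM bc fc.
have /choice[X XP] : forall v, exists X : set H,
    compact X /\ subgroup_generated X = stabiliser act v.
  by move=> v; have [X cX genX] := stab v; exists X.
pose M : set V := range r `|` N.
have finM : finite_set M by rewrite finite_setU.
pose YH : set H := (DH `|` hh @` M) `|` \bigcup_(v in range r) X v.
pose YB : set B := DB `|` A.
have cYH : compact YH.
  apply: compactU; last by apply: compact_bigcup => // v _; exact: (XP v).1.
  by apply: compactU => //; apply: finite_compact; exact: finite_image.
have cYB : compact YB by exact: compactU.
have [CH cCH extH] := presH YH cYH.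
have [CB cCB extB] := presB YB cYB.
pose C1 := wreath_generators (i \o e) j M YH YB.
have cC1 : compact C1.
  apply: compactU.
    by apply: compactU; [exact: compact_image | exact: cbs].
  rewrite (_ : mkset _ = \bigcup_(v in M) (cp v @` YB)) //.
  by apply: compact_bigcup => // v _; apply: compact_image.
pose D := C1 `|` [set x * y | x in C1 & y in C1].
have cD : compact D by apply: compactU => //; exact: compact_mulg.
pose C := (D `|` j @` CH) `|` \bigcup_(v in range r) (cp v @` CB).
exists (wreath_compact_open e i j W), D, C; split; split.
- exact: (subgroup_wreath_compact_open subA eM iM jM jbs sW).
- exact: (open_wreath_compact_open bo fo oW).
- exact: (compact_wreath_compact_open compactA iM jM bc fc cW).
- move=> _ [_ [a _ <-] [_ [w Ww <-] <-]]; right.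
  exists (i (e (pp_base adj a))); first by left; right; exists a.
  by exists (j w) => //; left; left; exists w => //; left; left; exact: WD.
- exact: cD.
- apply/seteqP; split=> // x _.
  apply: (wreath_generated iotaM jM jcp bij hhP genH genB).
  + exact: generated_subgroup.
  + move=> h Dh; apply: subset_generated; left; left; left; exists h => //.
    by left; left.
  + by move=> a; apply: subset_generated; left; left; right; exists a.
  + move=> v b Db; apply: subset_generated; left; right; exists (r v).
      by left; exists v.
    by exists b => //; left.
- apply: compactU; first by apply: compactU => //; exact: compact_image.
  by apply: compact_bigcup => // v _; apply: compact_image.
move=> Q f fM.
have [|gH gHM gHf] := extH Q (f \o j).
  move=> x y Cx Cy Cxy /=; rewrite jM fM // -?jM; left; right.
  - by exists x.
  - by exists y.
  - by exists (x * y).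
have /choice[gB gBP] : forall v, exists g : B -> Q, range r v ->
    {morph g : x y / x * y} /\ forall b, YB b -> g b = f (cp v b).
  move=> v; have [rv|nrv] := pselect (range r v); last by exists (fun _ => 1).
  have cpM : {morph cp v : b c / b * c} := copyM iotaM v.
  have [|g gM gf] := extB Q (f \o cp v); last by exists g.
  move=> x y Cx Cy Cxy /=; rewrite cpM fM // -?cpM; right; exists v => //.
apply: (wreath_extension actV iotaM jM jcp jbs bij hhP r_act genH genB
  (M := M) (YH := YH) (YB := YB) (X := X) _ _ _ _ _ _ _ _ _ gHM gHf (gB := gB)).
- by move=> v; left; exists v.
- by move=> v Mv; left; right; exists v.
- by move=> h Dh; left; left.
- by move=> b Db; left.
- by move=> b Ab; right.
- by move=> v; exact: (XP v).2.
- by move=> v x Xx; right; exists (r v) => //; exists v.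
- move=> v w /edgeN[h [v' [w' [Nv Nw vw ev ew]]]]; exists h, v', w'.
  by split=> //; right.
- by apply: partially_multiplicativeS fM => x Dx; left; left.
- by move=> v; apply: (gBP (r v) _).1; exists v.
- by move=> v b Yb; apply: (gBP (r v) _).2 => //; exists v.
Qed.

End GraphWreathProduct.

Unset Implicit Arguments.

Theorem proposition6p3
  (B H G : topGroupType) (A : set B)
  (V : discreteTopologicalType) (adj : rel V) (act : H -> V -> V)
  (tdlcB : tdlc B) (tdlcH : tdlc H)
  (subA : subgroup A) (compactA : compact A) (openA : open A)
  (graphV : simple_graph adj)
  (actV : graph_action adj act) (cont_act : continuous_action act)
  (GW : is_graph_wreath_product A adj act G) :
  (compactly_generated [set: B] ->
   compactly_generated [set: H] ->
   finitely_many_orbits act [set: V] ->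
   compactly_generated [set: G])
  /\
  (compactly_presented B ->
   compactly_presented H ->
   (forall v : V, compactly_generated (stabiliser act v)) ->
   finitely_many_orbits act [set: V] ->
   finitely_many_orbits (edge_action act) (edges adj) ->
   compactly_presented G).
Proof.
split=> [genB genH finV|presB presH stab finV finE].
  exact: (wreath_compactly_generated subA compactA openA actV GW).
have tdlcG : tdlc G by have [P [e [i [j [_ []]]]]] := GW.
apply: boundedly_presented_compactly => //.
apply: (wreath_boundedly_presented subA compactA openA graphV actV GW) => //;
  exact: compactly_boundedly_presented.
Qed.
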